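(* For $y\in(0,\pi/4)$ let $c_0=\tfrac{1}{\sqrt2}(\cos^2y+i\sin^2y)$, $c_1=\tfrac{1}{\sqrt2}(\sin^2y+i\cos^2y)$, $c_2=c_3=\tfrac{1}{\sqrt2}(1+i)\sin y\cos y$, and $U=\sum_{j=0}^3c_j\sigma_j\otimes\sigma_j$. Then $$K_E(U)=H(|c_0|^2,|c_0|^2,|c_2|^2,|c_2|^2)=H\big(\tfrac12(\cos^4y+\sin^4y),\tfrac12(\cos^4y+\sin^4y),\sin^2y\cos^2y,\sin^2y\cos^2y\big)\ \text{ebits},$$ attained by the input state $\frac{1}{\sqrt2}(|00\rangle+|11\rangle)_{AR_A}\otimes\frac{1}{\sqrt2}(|00\rangle+|11\rangle)_{BR_B}$.
   Context: Pauli matrices: $\sigma_0=I$, $\sigma_1=\begin{pmatrix}0&1\\1&0\end{pmatrix}$, $\sigma_2=\begin{pmatrix}0&-i\\i&0\end{pmatrix}$, $\sigma_3=\begin{pmatrix}1&0\\0&-1\end{pmatrix}$; $U$ acts on qubits $A,B$. The entangling power is $K_E(U)=\max E\big(U(|\phi\rangle_{AR_A}\otimes|\psi\rangle_{BR_B})\big)$, the maximum over pure states on $AR_A$ and $BR_B$ with arbitrary finite-dimensional ancillas $R_A,R_B$ ($U$ acting on $A,B$), where $E(|\chi\rangle)=S(\mathrm{Tr}_{AR_A}|\chi\rangle\langle\chi|)$ is the von Neumann entropy, base-2 logarithm (ebits). $H$ is the base-2 Shannon entropy. *)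

(* Defs.v *)
From HB Require Import structures.
From mathcomp Require Import all_boot all_order all_algebra.
From mathcomp Require Import complex.
From mathcomp Require Import reals exp trigo.
Set Implicit Arguments. Unset Strict Implicit. Unset Printing Implicit Defensive.
Import Order.TTheory GRing.Theory Num.Theory.
Local Open Scope ring_scope.
Local Open Scope complex_scope.

Section Defs.
Variable R : realType.
Local Notation C := R[i].

(* index k : 'I_(p*q) <-> pair (i,j) : 'I_p * 'I_q (the bijection used by mxvec) *)
Definition unpair (p q : nat) (k : 'I_(p * q)) : 'I_p * 'I_q :=
  enum_val (cast_ord (esym (mxvec_cast p q)) k).

Definition pauli (j : 'I_4) : 'M[C]_2 :=
  match val j with
  | 0 => 1%:M
  | 1 => \matrix_(a, b) (if a == b then 0 else 1)
  | 2 => \matrix_(a, b) (if a == b then 0 else if val a == 0%N then - 'i else 'i)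
  | _ => \matrix_(a, b) (if a == b then (if val a == 0%N then 1 else -1) else 0)
  end.

(* A two-qubit gate on A,B, given by its matrix entries
   U a b a' b' = <a b| U |a' b'>. *)
Definition gate := 'I_2 -> 'I_2 -> 'I_2 -> 'I_2 -> C.

Definition pauli_diag_gate (c : 'I_4 -> C) : gate :=
  fun a b a' b' => \sum_(j < 4) c j * pauli j a a' * pauli j b b'.

(* A pure state on A R_A (A a qubit, R_A of dimension m) is given by its
   coefficient matrix phi a r = <a r|phi>. *)
Definition unit_state (m : nat) (phi : 'M[C]_(2, m)) : Prop :=
  \sum_(a < 2) \sum_(r < m) `|phi a r| ^+ 2 = 1.

(* Coefficients of U (phi (x) psi) :
   chi a ra b rb = <a ra b rb| U (phi_{A R_A} (x) psi_{B R_B}) >,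
   U acting on A,B only. *)
Definition out_state (U : gate) (m n : nat) (phi : 'M[C]_(2, m))
  (psi : 'M[C]_(2, n)) : 'I_2 -> 'I_m -> 'I_2 -> 'I_n -> C :=
  fun a ra b rb => \sum_(a' < 2) \sum_(b' < 2) U a b a' b' * phi a' ra * psi b' rb.

Definition reduced_BRB (m n : nat) (chi : 'I_2 -> 'I_m -> 'I_2 -> 'I_n -> C)
  : 'M[C]_(2 * n) :=
  \matrix_(k, l) \sum_(a < 2) \sum_(ra < m)
      chi a ra (unpair k).1 (unpair k).2 * (chi a ra (unpair l).1 (unpair l).2)^*.

Definition negxlog2x (x : R) : R := if x == 0 then 0 else - (x * (ln x / ln 2)).

Definition shannon (p : seq R) : R := \sum_(x <- p) negxlog2x x.

(* s is the von Neumann entropy (base 2) of rho: s = - sum_i lambda_i log2 lambda_i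
   where the lambda_i are the eigenvalues of rho counted with multiplicity
   (the roots of its characteristic polynomial). *)
Definition vN_entropy (k : nat) (rho : 'M[C]_k) (s : R) : Prop :=
  exists rs : seq C,
    char_poly rho = \prod_(z <- rs) ('X - z%:P) /\
    s = \sum_(z <- rs) negxlog2x (complex.Re z).

Definition entanglement_of (U : gate) (m n : nat) (phi : 'M[C]_(2, m))
  (psi : 'M[C]_(2, n)) (s : R) : Prop :=
  vN_entropy (reduced_BRB (out_state U phi psi)) s.

Definition entangling_power_is (U : gate) (k : R) : Prop :=
  (forall (m n : nat) (phi : 'M[C]_(2, m)) (psi : 'M[C]_(2, n)) (s : R),
      unit_state phi -> unit_state psi -> entanglement_of U phi psi s -> s <= k)
  /\ (exists (m n : nat) (phi : 'M[C]_(2, m)) (psi : 'M[C]_(2, n)),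
      unit_state phi /\ unit_state psi /\ entanglement_of U phi psi k).

Definition bell : 'M[C]_(2, 2) :=
  \matrix_(a, r) (if a == r then ((Num.sqrt (2 : R))^-1)%:C else 0).

Definition coefs (y : R) (j : 'I_4) : C :=
  let s2 := ((Num.sqrt (2 : R))^-1)%:C in
  match val j with
  | 0 => s2 * ((cos y ^+ 2)%:C + 'i * (sin y ^+ 2)%:C)
  | 1 => s2 * ((sin y ^+ 2)%:C + 'i * (cos y ^+ 2)%:C)
  | _ => s2 * (1 + 'i) * (sin y * cos y)%:C
  end.

End Defs.

(* Main.v *)
(** Write [th = 2 y] and [q = sin^2 th / 2].  In the eigenbasis of [sigma_1] the gate is,
    up to a global phase, the identity on the span of [++], [--] and
    [- i cos th + sin th SWAP] on the span of [+-], [-+]; the claimed value is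
    [1 + h q] with [h] the binary entropy.

    The entropy of the output is at most the Shannon entropy of a measurement of [B R_B]
    in an orthonormal frame of its support.  Write the input of Bob as
    [|+> psi_0 + |-> psi_1] and take the frame [|+> e_0, |+> e_0', |-> e_1, |-> e_1'],
    where [e_j] is parallel to [psi_j] and [e_j'] completes it to a basis of
    [span (psi_0, psi_1)].  Only the swap term reaches the primed vectors, and their total
    probability is [t = 2 q w (1 - F)], where [w] is the probability that the inputs have
    opposite [sigma_1] eigenvalues and [F] is the normalised overlap of [psi_0] and [psi_1].
    If [t <= q], two outcomes in each of the two groups give at most [1 + h t <= 1 + h q].
    If [t > q], then [w > 1/2] forces the distribution inside each group to be unbalanced,
    and by Pinsker's inequality the entropy lost there exceeds the gain
    [(t - q) ln ((1 - q) / q)].  This step may require exchanging the roles of Alice and Bob,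
    which is harmless since both reduced states have the same nonzero spectrum.

    For the Bell inputs the reduced state is diagonal in the basis [sigma_j / sqrt 2] with
    eigenvalues [|c_j|^2]. *)

Require Import Defs.
From HB Require Import structures.
From mathcomp Require Import all_boot all_order all_algebra.
From mathcomp Require Import complex spectral ring lra.
From mathcomp Require Import reals normedtype derive realfun sequences exp trigo.
Import Order.TTheory GRing.Theory Num.Theory.
Import numFieldNormedType.Exports.
Local Open Scope ring_scope.
Local Open Scope complex_scope.

Set Implicit Arguments. Unset Strict Implicit. Unset Printing Implicit Defensive.

(** * Entropy inequalities *)

Section Entropy.
Variable R : realType.
Implicit Types x y p q t z s u v : R.

Definition negxlnx x : R := - (x * ln x).

Lemma negxlnx0 : negxlnx 0 = 0. Proof. by rewrite /negxlnx mul0r oppr0. Qed.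

Lemma negxlog2xE x : negxlog2x x = negxlnx x / ln 2.
Proof.
rewrite /negxlog2x /negxlnx; case: eqP => [->|_]; first by rewrite mul0r oppr0 mul0r.
by rewrite mulNr mulrA.
Qed.

Lemma ln_le_subr1 x : 0 < x -> ln x <= x - 1.
Proof.
move=> x0; have := @le_ln1Dx _ (x - 1).
by rewrite (_ : 1 + (x - 1) = x); [apply; lra|ring].
Qed.

(** Concavity as a tangent at [p], from [ln (p / x) <= p / x - 1]; this form also covers [x = 0]. *)
Lemma negxlnx_tangent x p : 0 <= x -> 0 < p -> negxlnx x <= - (x * ln p) + (p - x).
Proof.
rewrite le_eqVlt => /predU1P[<- p0|x0 p0]; first by rewrite negxlnx0; lra.
have h : ln p - ln x <= p / x - 1.
  by rewrite -ln_div ?posrE// ln_le_subr1// divr_gt0.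
have : x * (ln p - ln x) <= x * (p / x - 1) by rewrite ler_pM2l.
rewrite [X in _ <= X]mulrBr mulr1 mulrCA divff ?gt_eqF// mulr1 /negxlnx; lra.
Qed.

(** Jensen for sub-normalised weights: summing the tangents at the mean [p] leaves only the error
    [p * (\sum_i d i - 1) <= 0]. *)
Lemma negxlnx_jensen (I : finType) (d l : I -> R) :
  (forall i, 0 <= d i) -> (forall i, 0 <= l i) -> \sum_i d i <= 1 ->
  \sum_i d i * negxlnx (l i) <= negxlnx (\sum_i d i * l i).
Proof.
move=> d0 l0 d1; set p := \sum_i d i * l i.
have dl0 i : 0 <= d i * l i by rewrite mulr_ge0.
have : 0 <= p by apply: sumr_ge0 => i _.
rewrite le_eqVlt => /predU1P[p0|p0].
  rewrite -p0 negxlnx0 big1// => i _.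
  have /eqP := esym p0; rewrite psumr_eq0// => /allP/(_ i); rewrite mem_index_enum.
  move=> /(_ isT)/=; rewrite mulf_eq0 => /orP[]/eqP->; by rewrite ?mul0r ?negxlnx0 ?mulr0.
have h i : d i * negxlnx (l i) <= - ln p * (d i * l i) + (p * d i - d i * l i).
  by have := ler_wpM2l (d0 i) (@negxlnx_tangent _ _ (l0 i) p0); lra.
apply: le_trans (ler_sum _ (fun i _ => h i)) _.
rewrite big_split/= sumrB -!mulr_sumr -/p /negxlnx.
have : p * \sum_i d i <= p * 1 by rewrite ler_pM2l.
lra.
Qed.

Lemma is_derive_ge0 (f df : R -> R) :
  (forall x, 0 <= x < 1 -> is_derive x 1 f (df x)) ->
  (forall x, 0 <= x < 1 -> 0 <= df x) -> f 0 = 0 ->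
  forall x, 0 <= x < 1 -> 0 <= f x.
Proof.
move=> fd fd0 f0 x /andP[x0 x1].
have sub y : y \in `[0, x] -> 0 <= y < 1.
  by rewrite in_itv/= => /andP[->/= yx]; apply: le_lt_trans x1.
have suboo y : y \in `]0, x[ -> 0 <= y < 1 by move=> /subset_itv_oo_cc /sub.
have [|y yx] := @MVT_segment _ f df 0 x x0 (fun y yx => fd y (suboo y yx)).
  apply: derivable_within_continuous => y /sub /fd h; exact: ex_derive.
rewrite f0 subr0 => ->; rewrite mulr_ge0 ?subr0//; exact/fd0/sub.
Qed.

Lemma is_derive_ln1D (x : R) : 0 < 1 + x ->
  is_derive x 1 (fun y => ln (1 + y)) (1 + x)^-1.
Proof.
move=> h; have := @is_derive1_comp _ (@ln R) (fun y => 1 + y) x _ _ (is_derive1_ln h) _.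
move=> /(_ 1); rewrite mulr1; apply; apply: is_derive_eq; ring.
Qed.

Lemma is_derive_ln1B (x : R) : 0 < 1 - x ->
  is_derive x 1 (fun y => ln (1 - y)) (- (1 - x)^-1).
Proof.
move=> h; have := @is_derive1_comp _ (@ln R) (fun y => 1 - y) x _ _ (is_derive1_ln h) _.
move=> /(_ (-1)); rewrite mulrN1; apply; apply: is_derive_eq; ring.
Qed.

Lemma ln1D_ln1B_ge x : 0 <= x < 1 -> 0 <= ln (1 + x) - ln (1 - x) - 2 * x.
Proof.
move: x; apply: (@is_derive_ge0 _ (fun x => (1 + x)^-1 + (1 - x)^-1 - 2)).
- move=> x /andP[x0 x1].
  have d1 := @is_derive_ln1D x ltac:(lra); have d2 := @is_derive_ln1B x ltac:(lra).
  by apply: is_derive_eq; rewrite opprK scaler1.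
- move=> x /andP[x0 x1].
  have h1 : 0 < 1 + x by lra. have h2 : 0 < 1 - x by lra.
  have -> : (1 + x)^-1 + (1 - x)^-1 = 2 / ((1 + x) * (1 - x)).
    by field; rewrite !gt_eqF.
  rewrite subr_ge0 ler_pdivlMr ?mulr_gt0//; nra.
- by rewrite addr0 subr0 mulr0 !subr0 subrr.
Qed.

Lemma ln2_ge : 1 / 2 <= ln 2 :> R.
Proof.
have := @ln_le_subr1 (2^-1); rewrite lnV ?posrE//; lra.
Qed.

(** Two integrations from [0]: the difference of the sides has derivative
    [ln (1 + x) - ln (1 - x) - 2 * x], itself nonnegative by the same argument. *)
Lemma pinsker x : 0 <= x <= 1 -> negxlnx (1 + x) + negxlnx (1 - x) <= - x ^+ 2.
Proof.
case/andP => x0; rewrite le_eqVlt => /predU1P[->|x1].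
  (* At [x = 1] the derivative is singular; the claim there is [1 <= 2 ln 2]. *)
  by rewrite subrr negxlnx0 /negxlnx; have := ln2_ge; lra.
suff : forall x, 0 <= x < 1 ->
    0 <= (1 + x) * ln (1 + x) + (1 - x) * ln (1 - x) - x ^+ 2.
  by move=> /(_ x); rewrite x0 x1 /negxlnx => /(_ isT); lra.
apply: (@is_derive_ge0 _ (fun x => ln (1 + x) - ln (1 - x) - 2 * x)).
- move=> {x0 x1}x /andP[x0 x1].
  have h1 : 0 < 1 + x by lra. have h2 : 0 < 1 - x by lra.
  have d1 := is_derive_ln1D h1; have d2 := is_derive_ln1B h2.
  apply: is_derive_eq; rewrite /GRing.scale/=.
  by field; rewrite !gt_eqF.
- exact: ln1D_ln1B_ge.
- by rewrite addr0 subr0 ln1 mulr0 addr0 expr0n subrr.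
Qed.

(** [pinsker] rescaled, the pair being [p / 2 * (1 + r)] and [p / 2 * (1 - r)]. The last term is the
    entropy lost to imbalance. *)
Lemma negxlnx_pair x y : 0 <= x -> 0 <= y -> 0 < x + y ->
  negxlnx x + negxlnx y <= negxlnx (x + y) + (x + y) * ln 2 - (x - y) ^+ 2 / (2 * (x + y)).
Proof.
wlog: x y / y <= x.
  move=> wl x0 y0 xy0; have [/wl|/ltW/wl h] := leP y x; first exact.
  by rewrite addrC [x + y]addrC -sqrrN opprB; apply: h => //; rewrite addrC.
move=> yx x0 y0 p0; set p := x + y; set r := (x - y) / p.
have r01 : 0 <= r <= 1.
  by rewrite divr_ge0 ?(ltW p0) ?subr_ge0//= ler_pdivrMr// mul1r /p; lra.
have scale e : 0 <= e -> negxlnx (p / 2 * e) = p / 2 * negxlnx e - p / 2 * e * (ln p - ln 2).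
  rewrite le_eqVlt => /predU1P[<-|e0]; first by rewrite !mulr0 !negxlnx0; lra.
  rewrite /negxlnx lnM ?posrE ?divr_gt0// ln_div ?posrE//; lra.
have pn0 : p != 0 by rewrite gt_eqF.
have xE : x = p / 2 * (1 + r) by rewrite /r /p in pn0 *; field.
have yE : y = p / 2 * (1 - r) by rewrite /r /p in pn0 *; field.
case/andP: (r01) => r0 r1.
have -> : (x - y) ^+ 2 / (2 * p) = p / 2 * r ^+ 2 by rewrite /r; field.
rewrite {1}xE {1}yE !scale; [|lra|lra].
have : p / 2 * (negxlnx (1 + r) + negxlnx (1 - r)) <= p / 2 * (- r ^+ 2).
  by rewrite ler_pM2l ?divr_gt0//; exact: pinsker.
by rewrite [negxlnx p]/negxlnx; lra.
Qed.

Lemma negxlnx_binary_tangent t q : 0 <= t <= 1 -> 0 < q < 1 ->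
  negxlnx t + negxlnx (1 - t) <= negxlnx q + negxlnx (1 - q) + (t - q) * (ln (1 - q) - ln q).
Proof.
move=> /andP[t0 t1] /andP[q0 q1].
have := @negxlnx_tangent t q t0 q0.
have := @negxlnx_tangent (1 - t) (1 - q) ltac:(lra) ltac:(lra).
rewrite /negxlnx; lra.
Qed.

(** [(33 / 32) ^ 32] bounds [e] from below; it is reached by five squarings, rounded down. *)
Lemma e_ge : 267 / 100 <= expR 1 :> R.
Proof.
have -> : expR 1 = expR (1 / 32) ^+ 32 :> R.
  by rewrite -expRM_natl; congr expR; field.
have h0 : 33 / 32 <= expR (1 / 32) :> R by have := @expR_ge1Dx R (1 / 32); lra.
set e := expR _ in h0 *.
have -> : e ^+ 32 = ((((e ^+ 2) ^+ 2) ^+ 2) ^+ 2) ^+ 2 by ring.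
have h1 : 10634 / 10000 <= e ^+ 2 by nra.
have h2 : 11308 / 10000 <= (e ^+ 2) ^+ 2 by nra.
have h3 : 12787 / 10000 <= ((e ^+ 2) ^+ 2) ^+ 2 by nra.
have h4 : 16350 / 10000 <= (((e ^+ 2) ^+ 2) ^+ 2) ^+ 2 by nra.
nra.
Qed.

(** Tangent of [ln] at [e]. *)
Lemma ln_le_e x : 0 < x -> ln x <= x * (100 / 267).
Proof.
move=> x0; have e0 := expR_gt0 (1 : R); have e1 := e_ge.
have := @ln_le_subr1 (x / expR 1) (divr_gt0 x0 e0).
rewrite ln_div ?posrE// expRK.
have : x / expR 1 <= x * (100 / 267).
  rewrite ler_pM2l// -[leRHS]invrK lef_pV2 ?posrE//; lra.
lra.
Qed.

(** Tangent of [ln] at [e ^ 2], with [7 <= e ^ 2]. *)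
Lemma ln_le_e2 x : 0 < x -> ln x <= 1 + x / 7.
Proof.
move=> x0; have e0 := expR_gt0 (1 : R); have e1 := e_ge.
have e20 : 0 < expR 1 ^+ 2 :> R by rewrite exprn_gt0.
have := @ln_le_subr1 (x / expR 1 ^+ 2) (divr_gt0 x0 e20).
rewrite ln_div ?posrE// lnXn// expRK.
have : x / expR 1 ^+ 2 <= x / 7.
  rewrite ler_pM2l// lef_pV2 ?posrE//; nra.
lra.
Qed.
End Entropy.

(** * Entropy of the four-outcome measurement *)

Section FourOutcomes.
Variable R : realType.
Implicit Types x y p q t z s u v : R.

(* The difference of the two sides of [gap_bound], which is affine in [s], at [s = 11 / 20]. *)
Lemma gap_polynomial_ge0 z p : 0 <= z <= 1 -> 0 <= p <= 1 ->
  0 <= 7 / 40 - 9 / 40 * z + 1 / 4 * z ^+ 2 + 11 / 40 * (1 - z) * p ^+ 2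
       - 97 / 250 * p + 127 / 250 * z * p.
Proof.
move=> /andP[z0 z1] /andP[p0 p1].
(* The coefficient of [p] is negative up to [z = 97 / 127], just above [19 / 25]. At [z = 0] the
   minimum over [p] lies near [7 / 10]. *)
have [zb|zb] := leP z (19 / 25).
  have zp : 0 <= (19 / 25 - z) * (p - 7/10)^+2 by rewrite mulr_ge0 ?sqr_ge0 ?subr_ge0.
  have zp' : 0 <= (19 / 25 - z) * p by rewrite mulr_ge0 ?subr_ge0.
  have zp2 : 0 <= z * p by rewrite mulr_ge0.
  have zp3 : 0 <= z * p^+2 by rewrite mulr_ge0 ?sqr_ge0.
  nra.
have zp : 0 <= (z - 19 / 25) * p by rewrite mulr_ge0 // subr_ge0 ltW.
have zp2 : 0 <= (1 - z) * p ^+ 2 by rewrite mulr_ge0 ?sqr_ge0 ?subr_ge0.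
nra.
Qed.

(** Used with [p = sqrt (v / u)] and [r = sqrt u]. Once [r] is replaced by its bound, both sides are
    affine in [s]: [N0] is the end [s = 0], and [N1] the end [s = 11 / 20] up to rounding, which
    [M2] and [M3] absorb. *)
Lemma gap_bound s z p r : 0 <= s <= 11 / 20 -> 0 <= z <= 1 -> 0 <= p <= 1 ->
  r <= 1 - z / 2 ->
  (107 / 200 * (1 - s / 2) - 37 / 20 * (s / 2) * z) * p <=
  1 - s - s * ((1 - z) * (1 - p ^+ 2) / 2) - z * r / 2.
Proof.
move=> /andP[s0 s1] z01 p01 hr; have N1 := gap_polynomial_ge0 z01 p01.
case/andP: (z01) => z0 z1; case/andP: (p01) => p0 p1.
have zr : z * r <= z * (1 - z / 2) by rewrite ler_wpM2l.
have N0 : 0 <= 1 - z / 2 + z ^+ 2 / 4 - 107 / 200 * p by nra.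
have M0 : 0 <= (11 / 20 - s) * (1 - z / 2 + z ^+ 2 / 4 - 107 / 200 * p).
  by rewrite mulr_ge0// subr_ge0.
have M1 := mulr_ge0 s0 N1.
have M2 : 0 <= s * p by rewrite mulr_ge0.
have M3 : 0 <= s * z * p by rewrite !mulr_ge0.
lra.
Qed.


(** AM-GM on [a b] and [(1 - a) (1 - b)], whose sum is [(1 - u) / 2], bounds their product by
    [((1 - u) / 4) ^ 2]. With [4 s (1 - s) <= 1] and both overlaps at most [u / (1 + u)], this gives
    [|K| <= z u / 4]. *)
Lemma coherence_bound s a b F FA K u z :
  u = 2 * (a * (1 - b) + (1 - a) * b) - 1 -> z * (1 + u) = 1 - u ->
  0 <= s <= 1 -> 0 <= a <= 1 -> 0 <= b <= 1 -> 0 <= F -> 0 <= FA ->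
  K ^+ 2 <= 4 * s * (1 - s) * F * FA * (a * (1 - a) * b * (1 - b)) ->
  0 < u -> F * (1 + u) <= u -> FA * (1 + u) <= u -> 0 <= z ->
  `|2 * K| <= z * u / 2.
Proof.
move=> uE zE /andP[s0 s1] /andP[a0 a1] /andP[b0 b1] F0 FA0 hK u0 hF hFA z0.
have u1 : 0 <= 1 + u by rewrite addr_ge0// ltW.
rewrite -(@ler_pXn2r _ 2) ?nnegrE ?divr_ge0 ?mulr_ge0 ?(ltW u0)//.
rewrite real_normK ?num_real//.
have Pi0 : 0 <= a * (1 - a) * b * (1 - b) by rewrite !mulr_ge0 ?subr_ge0.
have Pi : a * (1 - a) * b * (1 - b) <= (1 - u) ^+ 2 / 16.
  have : 0 <= (a * b - (1 - a) * (1 - b)) ^+ 2 by rewrite sqr_ge0.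
  by clear -uE; rewrite uE; lra.
have s4 : 4 * s * (1 - s) <= 1.
  have : 0 <= (1 - 2 * s) ^+ 2 by rewrite sqr_ge0.
  by clear; lra.
have FF : (F * (1 + u)) * (FA * (1 + u)) <= u * u.
  by apply: ler_pM => //; rewrite mulr_ge0.
have h1 : 4 * s * (1 - s) * (F * FA * (a * (1 - a) * b * (1 - b))) <=
    1 * (F * FA * (a * (1 - a) * b * (1 - b))).
  by rewrite ler_wpM2r// mulr_ge0// mulr_ge0.
have h2 : F * FA * (a * (1 - a) * b * (1 - b)) <= F * FA * ((1 - u) ^+ 2 / 16).
  by rewrite ler_wpM2l// mulr_ge0.
have h3 : z ^+ 2 * ((F * (1 + u)) * (FA * (1 + u))) <= z ^+ 2 * (u * u).
  by rewrite ler_wpM2l// sqr_ge0.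
have h4 : z ^+ 2 * ((F * (1 + u)) * (FA * (1 + u))) = F * FA * (1 - u) ^+ 2.
  by rewrite -zE; ring.
by clear -h1 h2 h3 h4 hK; rewrite exprMn; lra.
Qed.

(** Equal signs of [E] and [D] exclude cancellation; this is why the sign of [(1 - a - b) * (a - b)]
    is tracked below. *)
Lemma ler_normMD (D E k : R) : 0 <= k -> 0 <= E * D -> `|D| * k <= `|E + D * k|.
Proof.
move=> k0 ED; have [D0|D0|->] := ltgtP D 0; last by rewrite normr0 mul0r.
- have E0 : E <= 0 by rewrite -(nmulr_lge0 _ D0).
  have Dk : D * k <= 0 by rewrite mulr_le0_ge0// ltW.
  by rewrite ltr0_norm// ler0_norm; clear -E0 Dk; lra.
- have E0 : 0 <= E by rewrite -(pmulr_lge0 _ D0).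
  have Dk : 0 <= D * k by rewrite mulr_ge0// ltW.
  by rewrite gtr0_norm// ger0_norm; clear -E0 Dk; lra.
Qed.

(** The right side is [(P1 - P3) ^ 2] in [four_outcome_entropy]. Its main part is at least
    [|a - b| * (1 - s - s * F)] with [|a - b| >= sqrt u], the interference costs at most [z u / 2],
    and [gap_bound] compares the remainder with [sqrt v]. *)
Lemma gap_sq s a b F FA K u v z :
  u = 2 * (a * (1 - b) + (1 - a) * b) - 1 -> v = (1 + u) * (1 - F) - 1 ->
  z = (1 - u) / (1 + u) ->
  0 <= s <= 11 / 20 -> 0 <= a <= 1 -> 0 <= b <= 1 -> 0 <= F -> 0 <= FA ->
  K ^+ 2 <= 4 * s * (1 - s) * F * FA * (a * (1 - a) * b * (1 - b)) ->
  0 < u <= 1 -> 0 <= v -> FA * (1 + u) <= u ->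
  0 <= (1 - a - b) * (a - b) ->
  0 <= 107 / 200 * (1 - s / 2) - 37 / 20 * (s / 2) * z ->
  (107 / 200 * (1 - s / 2) - 37 / 20 * (s / 2) * z) ^+ 2 * v <=
    ((1 - a - b) + (a - b) * (1 - s - s * F) - 2 * K) ^+ 2.
Proof.
move=> uE vE zdef s01 a01 b01 F0 FA0 hK /andP[u0 u1] v0 hFA hED m0.
have up : 0 < 1 + u by rewrite addr_gt0.
have zE : z * (1 + u) = 1 - u by rewrite zdef divfK// gt_eqF.
have z0 : 0 <= z by rewrite zdef divr_ge0 ?subr_ge0// ltW.
have z1 : z <= 1 by rewrite zdef ler_pdivrMr//; clear -u0; lra.
have hF : F * (1 + u) <= u by clear -vE v0; lra.
have K2 : `|2 * K| <= z * u / 2.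
  apply: (coherence_bound uE zE _ a01 b01 F0 FA0 hK) => //.
  by clear -s01; lra.
have vu : v <= u.
  have Fu : 0 <= F * (1 + u) by rewrite mulr_ge0// ltW.
  by clear -vE Fu; lra.
pose ru := Num.sqrt u; pose p := Num.sqrt (v / u).
have ru0 : 0 <= ru := sqrtr_ge0 _. have p0 : 0 <= p := sqrtr_ge0 _.
have ruE : ru ^+ 2 = u by rewrite sqr_sqrtr// ltW.
have pE : p ^+ 2 = v / u by rewrite sqr_sqrtr// divr_ge0// ltW.
have pE' : p ^+ 2 * u = v by rewrite pE divfK// gt_eqF.
have p1 : p <= 1.
  by rewrite -(@ler_pXn2r _ 2) ?nnegrE// expr1n pE ler_pdivrMr// mul1r.
move: ru p ru0 p0 ruE pE' p1 {pE} => ru p ru0 p0 ruE pE p1.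
have ruz : ru <= 1 - z / 2.
  have hz : 0 <= 1 - z / 2 by clear -z1; lra.
  rewrite -(@ler_pXn2r _ 2) ?nnegrE// ruE.
  by clear -z0 z1 zE u0; nra.
have FE : F = (1 - z) * (1 - p ^+ 2) / 2.
  have h : (1 + u) != 0 by rewrite gt_eqF.
  apply: (mulIf h).
  have -> : (1 - z) * (1 - p ^+ 2) / 2 * (1 + u) =
      (1 + u - z * (1 + u)) * (1 - p ^+ 2) / 2 by ring.
  by rewrite zE; clear -pE vE; lra.
have := @gap_bound s z p ru s01 ltac:(by rewrite z0) ltac:(by rewrite p0) ruz.
rewrite -FE; move: (107 / 200 * _ - _) m0 => m m0.
move: (1 - s - s * F) => k hm.
have k0 : 0 <= k.
  have mp : 0 <= m * p by rewrite mulr_ge0.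
  have zr : 0 <= z * ru by rewrite mulr_ge0.
  by clear -mp zr hm; lra.
(* [u = (a - b) ^ 2 - (1 - a - b) ^ 2]. *)
have ruD : ru <= `|a - b|.
  rewrite -(@ler_pXn2r _ 2) ?nnegrE// real_normK ?num_real// ruE uE.
  have : 0 <= (1 - a - b) ^+ 2 by rewrite sqr_ge0.
  by clear; lra.
have fin : m * (p * ru) <= `|(1 - a - b) + (a - b) * k - 2 * K|.
  have h1 := lerB_dist ((1 - a - b) + (a - b) * k) (2 * K).
  have h2 : ru * k <= `|a - b| * k by rewrite ler_wpM2r.
  have h3 : ru * (m * p) <= ru * (k - z * ru / 2) by rewrite ler_wpM2l.
  have h4 : ru * (z * ru / 2) = z * u / 2 by rewrite -ruE; ring.
  have h5 := ler_normMD k0 hED.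
  by clear -h1 h2 h3 h4 h5 K2; lra.
have -> : m ^+ 2 * v = (m * (p * ru)) ^+ 2 by rewrite -pE -ruE; ring.
by rewrite -[leRHS]real_normK ?num_real// ler_pXn2r ?nnegrE// !mulr_ge0.
Qed.

Lemma negxlnx_pair_le x y : 0 <= x -> 0 <= y ->
  negxlnx x + negxlnx y <= negxlnx (x + y) + (x + y) * ln 2.
Proof.
move=> x0 y0; have : 0 <= x + y by rewrite addr_ge0.
rewrite le_eqVlt => /predU1P[/esym/eqP|p0].
  rewrite paddr_eq0// => /andP[/eqP-> /eqP->].
  by rewrite !addr0 mul0r !negxlnx0 addr0.
apply: le_trans (negxlnx_pair x0 y0 p0) _.
by rewrite gerBl divr_ge0 ?sqr_ge0// mulr_ge0// ltW.
Qed.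

(** The entropy lost to the imbalance of the primed outcomes [P2] and [P4], with [d2] for
    [(a - b) ^ 2]. It reduces to [v / (1 + v) <= u / (1 + u)]. *)
Lemma imbalance_gain q u v z d2 : 0 < q -> 0 < v <= u -> 2 / (1 + u) = 1 + z ->
  u <= d2 ->
  q * v * (1 + z) <= (q * (1 + v) * (1 + z)) ^+ 2 * d2 / (2 * (q * (1 + v))).
Proof.
move=> q0 /andP[v0 vu] zE ud; have u0 := lt_le_trans v0 vu.
have up : 0 < 1 + u by rewrite addr_gt0.
have z1 : 0 < 1 + z by rewrite -zE divr_gt0.
have v1 : 0 < 1 + v by rewrite addr_gt0.
have -> : (q * (1 + v) * (1 + z)) ^+ 2 * d2 / (2 * (q * (1 + v))) =
    (q * (1 + z)) * ((1 + v) * (1 + z) * d2 / 2).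
  by field; rewrite !gt_eqF.
rewrite mulrAC ler_pM2l ?mulr_gt0//.
have h : (1 + v) * (1 + z) * u <= (1 + v) * (1 + z) * d2.
  by rewrite ler_pM2l// mulr_gt0.
have h' : v <= (1 + v) * (1 + z) * u / 2.
  rewrite -zE (_ : _ / 2 = (1 + v) * u / (1 + u)); last by field; rewrite gt_eqF.
  by rewrite ler_pdivlMr//; clear -vu; lra.
by clear -h h'; lra.
Qed.

(* The tangent bounds [ln x <= x / e] and [ln x <= 1 + x / e ^ 2] cover [q >= 11/40]
   and [q <= 11/40] respectively; [107/200] and [37/20] are such that the square in the last
   hypothesis dominates [2 (1 - q) ((1 - q) / 7 - q z)]. *)
Lemma excess_bound q v z r : 0 < q -> q < 1 / 2 -> 0 < v -> 0 <= z -> 0 <= r ->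
  q * (1 + v) < 1 ->
  (2 * q <= 11 / 20 -> 0 <= 107 / 200 * (1 - q) - 37 / 20 * q * z ->
    (107 / 200 * (1 - q) - 37 / 20 * q * z) ^+ 2 * v <= r) ->
  q * v * ln ((1 - q) / q) <= q * v * (1 + z) + r / (2 * (1 - q * (1 + v))).
Proof.
move=> q0 q1 v0 z0 r0 t1 hg.
have qv0 : 0 < q * v by rewrite mulr_gt0.
have q1' : 0 < 1 - q by clear -q1; lra.
have x0 : 0 < (1 - q) / q by rewrite divr_gt0.
have tp : 0 < 2 * (1 - q * (1 + v)) by clear -t1; lra.
have g0 : 0 <= r / (2 * (1 - q * (1 + v))) by rewrite divr_ge0// ltW.
have [s55|s55] := leP (11 / 20) (2 * q).
  have L1 : ln ((1 - q) / q) <= 1.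
    apply: le_trans (ln_le_e x0) _.
    by rewrite mulrAC ler_pdivrMr//; clear -s55; lra.
  have h : q * v * ln ((1 - q) / q) <= q * v * (1 + z).
    by rewrite ler_pM2l//; clear -L1 z0; lra.
  by clear -h g0; lra.
have L2 : q * v * ln ((1 - q) / q) <= v * (q + (1 - q) / 7).
  rewrite (_ : v * _ = q * v * (1 + (1 - q) / q / 7)); last by field; rewrite gt_eqF.
  by rewrite ler_pM2l//; exact: ln_le_e2.
suff : v * ((1 - q) / 7 - q * z) <= r / (2 * (1 - q * (1 + v))) by clear -L2; lra.
have qz0 : 0 <= q * z by rewrite mulr_ge0// ltW.
have [B0|B0] := leP ((1 - q) / 7 - q * z) 0.
  by apply: le_trans g0; rewrite mulr_ge0_le0// ltW.
have m0 : 0 <= 107 / 200 * (1 - q) - 37 / 20 * q * z by clear -B0 qz0 q1'; lra.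
rewrite ler_pdivlMr//; apply: le_trans (hg (ltW s55) m0).
have m2 : (1 - q) * (2 / 7 * (1 - q) - 2 * (q * z)) <=
    (107 / 200 * (1 - q) - 37 / 20 * q * z) ^+ 2.
  have h1 : 0 <= (q * z) * (1 - q) by rewrite mulr_ge0// ltW.
  have h2 : 0 <= (q * z) ^+ 2 by rewrite sqr_ge0.
  have h3 : 0 <= (1 - q) ^+ 2 by rewrite sqr_ge0.
  by clear -h1 h2 h3; lra.
have h1 := ler_wpM2r (ltW v0) m2.
have h2 : v * ((1 - q) / 7 - q * z) * (2 * (1 - q * (1 + v))) <=
    v * ((1 - q) / 7 - q * z) * (2 * (1 - q)).
  rewrite ler_pM2l ?mulr_gt0//; clear -qv0; lra.
by clear -h1 h2; lra.
Qed.

(* [P1, P2, P3, P4] are the probabilities of [|+> e_0, |+> e_0', |-> e_1, |-> e_1'], [a] and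
   [b] those of [+] in the inputs of Alice and Bob, [FA] and [F] the corresponding overlaps,
   and [K] is the interference term. *)
Lemma four_outcome_entropy s a b F FA K P1 P2 P3 P4
    (w := a * (1 - b) + (1 - a) * b) :
  0 < s < 1 -> 0 <= a <= 1 -> 0 <= b <= 1 -> 0 <= F <= 1 -> 0 <= FA <= 1 ->
  K ^+ 2 <= 4 * s * (1 - s) * F * FA * (a * (1 - a) * b * (1 - b)) ->
  P1 = a * b + (1 - s) * (1 - a) * b + s * a * (1 - b) * F + K ->
  P2 = s * a * (1 - b) * (1 - F) ->
  P3 = (1 - a) * (1 - b) + (1 - s) * a * (1 - b) + s * (1 - a) * b * F - K ->
  P4 = s * (1 - a) * b * (1 - F) -> 0 <= P1 -> 0 <= P3 ->
  s * w * (1 - F) <= s / 2 \/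
    s / 2 < s * w * (1 - FA) /\ 0 <= (1 - a - b) * (a - b) ->
  negxlnx P1 + negxlnx P2 + negxlnx P3 + negxlnx P4 <=
    ln 2 + negxlnx (s / 2) + negxlnx (1 - s / 2).
Proof.
move=> /andP[s0 s1] a01 b01 /andP[F0 F1] /andP[FA0 FA1] hK E1 E2 E3 E4 P10 P30 hc.
have [q qE] : exists q, q = s / 2 by exists (s / 2).
have sE : s = 2 * q by clear -qE; lra.
rewrite -qE in hc *.
have q0 : 0 < q by rewrite qE divr_gt0.
have q1 : q < 1 / 2 by clear -qE s1; lra.
have q1' : 0 < 1 - q by clear -q1; lra.
case/andP: (a01) => a0 a1; case/andP: (b01) => b0 b1.
have P20 : 0 <= P2 by rewrite E2 !mulr_ge0 ?subr_ge0// ltW.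
have P40 : 0 <= P4 by rewrite E4 !mulr_ge0 ?subr_ge0// ltW.
have [t tE] : exists t, t = s * w * (1 - F) by exists (s * w * (1 - F)).
rewrite -tE in hc.
have P24 : P2 + P4 = t by rewrite E2 E4 tE /w; ring.
have P13 : P1 + P3 = 1 - t by rewrite E1 E3 tE /w; ring.
have t0 : 0 <= t by rewrite -P24 addr_ge0.
have t1 : t <= 1 by rewrite -subr_ge0 -P13 addr_ge0.
have hb : negxlnx t + negxlnx (1 - t) <=
    negxlnx q + negxlnx (1 - q) + (t - q) * (ln (1 - q) - ln q).
  by apply: negxlnx_binary_tangent; rewrite ?t0 ?q0//=; clear -q1; lra.
(* Up to [q] the tangent term is nonpositive, and one bit inside each group is affordable. *)
have [tq|tq] := leP t q.
  have L0 : ln q <= ln (1 - q) by rewrite ler_ln ?posrE//; clear -q1; lra.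
  have hL : (t - q) * (ln (1 - q) - ln q) <= 0.
    by rewrite mulr_le0_ge0 ?subr_ge0 ?subr_le0.
  have h1 := negxlnx_pair_le P10 P30; have h2 := negxlnx_pair_le P20 P40.
  by rewrite P13 in h1; rewrite P24 in h2; clear -h1 h2 hL hb; lra.
case: hc => [|[tA hED]]; first by rewrite leNgt tq.
have w1 : w <= 1.
  have h1 : 0 <= a * b by rewrite mulr_ge0.
  have h2 : 0 <= (1 - a) * (1 - b) by rewrite mulr_ge0// subr_ge0.
  by clear -h1 h2; rewrite /w; lra.
have w0 : 0 <= w by rewrite /w addr_ge0// mulr_ge0// subr_ge0.
have t1' : t < 1.
  apply: le_lt_trans s1; rewrite tE -[leRHS]mulr1 -mulrA.
  by rewrite ler_pM2l// mulr_ile1 ?subr_ge0// gerBl.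
(* Normalised excesses: [2 w = 1 + u] and [t = q (1 + v)]; further down, [z = (1 - w) / w]. *)
have [u uE] : exists u, u = 2 * (a * (1 - b) + (1 - a) * b) - 1 by eexists.
have uw : 2 * w = 1 + u by rewrite uE /w; ring.
have [v vE] : exists v, v = (1 + u) * (1 - F) - 1 by eexists.
have tv : t = q * (1 + v) by rewrite tE sE vE -uw; ring.
have v0 : 0 < v.
  have : q * 1 < q * (1 + v) by rewrite mulr1 -tv.
  by rewrite ltr_pM2l// ltrDl.
have hFA : FA * (1 + u) <= u.
  have : q * 1 < q * ((1 + u) * (1 - FA)).
    by rewrite mulr1 -uw; apply: lt_le_trans tA _; rewrite sE; clear; lra.
  by rewrite ltr_pM2l//; clear; lra.
have u1 : u <= 1 by clear -uw w1; lra.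
have up : 0 <= 1 + u by rewrite -uw mulr_ge0.
have vu : v <= u.
  have Fu : 0 <= F * (1 + u) by rewrite mulr_ge0.
  by clear -vE Fu; lra.
have u0 := lt_le_trans v0 vu.
have up' : 0 < 1 + u by rewrite addr_gt0.
have [z zdef] : exists z, z = (1 - u) / (1 + u) by eexists.
have z0 : 0 <= z by rewrite zdef divr_ge0// subr_ge0.
have zE : 2 / (1 + u) = 1 + z by rewrite zdef; field; rewrite gt_eqF.
have tp : 0 < P2 + P4 by rewrite P24; exact: lt_trans tq.
have tp' : 0 < P1 + P3 by rewrite P13 subr_gt0.
have h24 := negxlnx_pair P20 P40 tp; have h13 := negxlnx_pair P10 P30 tp'.
have g24 : q * v * (1 + z) <= (P2 - P4) ^+ 2 / (2 * (P2 + P4)).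
  have -> : P2 - P4 = q * (1 + v) * (1 + z) * (a - b).
    rewrite E2 E4 -zE (_ : 1 + v = (1 + u) * (1 - F)); last by rewrite vE; ring.
    by rewrite sE; field; rewrite gt_eqF.
  rewrite P24 tv exprMn; apply: (imbalance_gain (u := u)) => //; first by rewrite v0.
  have : 0 <= (1 - a - b) ^+ 2 by rewrite sqr_ge0.
  by clear -uE; rewrite uE; lra.
(* The tangent term [q v ln ((1 - q) / q)] is paid for by the imbalances of both pairs together. *)
have g13 : q * v * ln ((1 - q) / q) <=
    q * v * (1 + z) + (P1 - P3) ^+ 2 / (2 * (P1 + P3)).
  rewrite P13 tv; apply: excess_bound => //; first exact: sqr_ge0.
    by rewrite -tv.
  rewrite -sE qE => s55 m0.
  have -> : (P1 - P3) ^+ 2 = ((1 - a - b) + (a - b) * (1 - s - s * F) - 2 * K) ^+ 2.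
    by rewrite E1 E3; ring.
  apply: (gap_sq uE vE zdef _ a01 b01 F0 FA0 hK _ (ltW v0) hFA hED m0).
    by rewrite ltW.
  by rewrite u0.
rewrite P24 in h24 g24; rewrite P13 in h13 g13.
have xE : (t - q) * (ln (1 - q) - ln q) = q * v * ln ((1 - q) / q).
  by rewrite ln_div ?posrE// tv; ring.
rewrite xE in hb.
by clear -hb h13 h24 g13 g24; lra.
Qed.
End FourOutcomes.

(** * Spectra and measurements *)

Section Spectrum.
Variable R : realType.
Local Notation C := R[i].
Local Open Scope sesquilinear_scope.

Lemma conjC_conjc (z : C) : Num.conj z = z^*%C.
Proof. by []. Qed.

Definition sqn (z : C) : R := complex.Re z ^+ 2 + complex.Im z ^+ 2.

Lemma sqn_ge0 z : 0 <= sqn z. Proof. by rewrite addr_ge0// sqr_ge0. Qed.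

Lemma sqnE z : (sqn z)%:C = z * z^*%C.
Proof. by rewrite add_Re2_Im2 sqr_normc. Qed.

(** Sylvester's identity: two left factors of the same determinant ['X^n] make [M1] block
    triangular, one with Schur complement ['X - A B], the other with ['X - B A]. *)
Lemma char_poly_mulC (K : comNzRingType) m n (A : 'M[K]_(m, n)) (B : 'M[K]_(n, m)) :
  'X^n * char_poly (A *m B) = 'X^m * char_poly (B *m A).
Proof.
pose Ax := map_mx polyC A; pose Bx := map_mx polyC B.
have -> : char_poly (A *m B) = \det (('X%:M : 'M_m) - Ax *m Bx).
  by rewrite /char_poly /char_poly_mx map_mxM.
have -> : char_poly (B *m A) = \det (('X%:M : 'M_n) - Bx *m Ax).
  by rewrite /char_poly /char_poly_mx map_mxM.
pose M1 := block_mx ('X%:M : 'M_m) Ax Bx (1%:M : 'M_n).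
have E1 : block_mx 1%:M (- Ax) 0 ('X%:M : 'M_n) *m M1 =
   block_mx ('X%:M - Ax *m Bx) 0 ('X *: Bx) 'X%:M.
  rewrite /M1 mulmx_block !mul1mx !mul0mx !mulmx1 !mulNmx subrr !add0r.
  by rewrite mul_scalar_mx.
have E2 : block_mx 1%:M 0 (- Bx) ('X%:M : 'M_n) *m M1 =
   block_mx 'X%:M Ax 0 ('X%:M - Bx *m Ax).
  rewrite /M1 mulmx_block !mul1mx !mul0mx !mulmx1 !mulNmx !addr0.
  rewrite mul_mx_scalar mul_scalar_mx addNr; congr block_mx.
  by rewrite addrC.
have := congr1 determinant E1; have := congr1 determinant E2.
rewrite !det_mulmx det_lblock det_ublock det_ublock det_lblock.
rewrite !det_scalar !expr1n !mul1r => -> H.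
by rewrite mulrC -H.
Qed.

(** The eigenvalue [l i] is the squared norm of column [i] of [N *m P^t*], hence real and
    nonnegative. *)
Lemma spectral_decomposition n p (N : 'M[C]_(p, n)) :
  exists (P : 'M[C]_n) (l : 'I_n -> R),
    [/\ P *m P^t* = 1%:M, P^t* *m P = 1%:M,
        N^t* *m N = P^t* *m diag_mx (\row_i (l i)%:C) *m P,
        forall i, 0 <= l i &
        char_poly (N^t* *m N) = \prod_i ('X - ((l i)%:C)%:P)].
Proof.
set rho := N^t* *m N.
have rhoH : rho^t* = rho by rewrite /rho trmx_mul map_mxM/= trmxCK.
have rn : rho \is normalmx by apply/normalmxP; rewrite rhoH.
have /orthomx_spectralP := rn.
set P := spectralmx rho; set d := spectral_diag rho => E.
have Pu : P \is unitarymx := spectral_unitarymx rho.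
have PP : P *m P^t* = 1%:M by apply/unitarymxP.
have PP' : P^t* *m P = 1%:M by apply: mulmx1C.
rewrite invmx_unitary// in E.
have dE : diag_mx d = (N *m P^t*)^t* *m (N *m P^t*).
  rewrite trmx_mul map_mxM/= trmxCK !mulmxA -[P *m N^t* *m N]mulmxA -/rho E.
  by rewrite !mulmxA PP mul1mx -mulmxA PP mulmx1.
pose l i := complex.Re (d 0 i).
have dl i : d 0 i = (\sum_k sqn ((N *m P^t*) k i))%:C.
  have := congr1 (fun X : 'M_n => X i i) dE; rewrite !mxE eqxx mulr1n => ->.
  rewrite rmorph_sum/=; apply: eq_bigr => k _.
  by rewrite sqnE 2!mxE mulrC.
have lE i : d 0 i = (l i)%:C by rewrite /l dl.
have dE' : d = \row_i (l i)%:C by apply/rowP => i; rewrite mxE lE.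
exists P, l; split => //.
- by rewrite -dE'.
- by move=> i; rewrite /l dl/=; apply: sumr_ge0 => k _; exact: sqn_ge0.
- have -> : \prod_i ('X - ((l i)%:C)%:P) = char_poly (diag_mx d).
    rewrite char_poly_trig ?diag_mx_is_trig//.
    by apply: eq_bigr => i _; rewrite !mxE eqxx mulr1n lE.
  rewrite E -mulmxA.
  have := char_poly_mulC (P^t*) (diag_mx d *m P).
  move/(mulfI _) => ->; last by rewrite monic_neq0// monicXn.
  by rewrite -mulmxA PP mulmx1.
Qed.
End Spectrum.

(** * Entropy bounds from measurement in a frame *)

Section Pinching.
Variable R : realType.
Local Notation C := R[i].
Local Open Scope sesquilinear_scope.

Lemma sum_sqn n (v : 'cV[C]_n) : (\sum_i sqn (v i 0))%:C = (v^t* *m v) 0 0.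
Proof.
rewrite mxE rmorph_sum/=; apply: eq_bigr => i _.
by rewrite sqnE 2!mxE mulrC.
Qed.

Lemma negxlog2x0 : negxlog2x 0 = 0 :> R.
Proof. by rewrite /negxlog2x eqxx. Qed.

Lemma ln2_gt0 : 0 < ln 2 :> R.
Proof. by apply: ln_gt0; rewrite ltr1n. Qed.

(** The two spectra differ only in the multiplicity of [0], which carries no entropy. *)
Lemma vN_entropy_mulC m n (A : 'M[C]_(m, n)) (B : 'M[C]_(n, m)) s :
  vN_entropy (A *m B) s -> vN_entropy (B *m A) s.
Proof.
case=> rs [AB ->].
have [rs' BA] := closed_field_poly_normal (char_poly (B *m A)).
rewrite (monicP (char_poly_monic _)) scale1r in BA.
exists rs'; split => //.
have prod0 k (t : seq C) : 'X^k * \prod_(z <- t) ('X - z%:P) =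
    \prod_(z <- nseq k 0 ++ t) ('X - z%:P).
  by rewrite big_cat/= big_nseq subr0 iter_mulr_1.
have sum0 k (t : seq C) : \sum_(z <- nseq k 0 ++ t) negxlog2x (complex.Re z) =
    \sum_(z <- t) negxlog2x (complex.Re z).
  rewrite big_cat/= big_nseq/= negxlog2x0.
  by elim: k => [|k IH] /=; rewrite ?add0r//= add0r.
have := char_poly_mulC A B; rewrite AB BA !prod0 => /prod_XsubC_eq pe.
by rewrite -(sum0 n) (perm_big _ pe) sum0.
Qed.

(* The [w k] form a Parseval frame of the row space of [N]; null vectors are allowed, so that
   degenerate inputs need no separate treatment. *)
Lemma pinching_bound n p (N : 'M[C]_(p, n)) (I : finType) (w : I -> 'cV[C]_n) s :
  (forall k, \sum_j sqn (w k j 0) <= 1) ->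
  N = \sum_k (N *m w k) *m (w k)^t* ->
  vN_entropy (N^t* *m N) s ->
  s <= \sum_k negxlog2x (\sum_i sqn ((N *m w k) i 0)).
Proof.
move=> w1 frame [rs [rsE ->]].
have [P [l [PP PP' NE l0]]] := spectral_decomposition N.
rewrite rsE => lE.
have {rsE lE} -> : \sum_(z <- rs) negxlog2x (complex.Re z) = \sum_i negxlog2x (l i).
  have : \prod_(z <- rs) ('X - z%:P) =
      \prod_(z <- [seq (l i)%:C | i <- enum 'I_n]) ('X - z%:P).
    by rewrite lE big_map enumT.
  by move=> /prod_XsubC_eq pe; rewrite (perm_big _ pe)/= big_map enumT.
(* [d k i] is the squared overlap of [w k] with the [i]-th eigenvector. *)
pose y k := P *m w k; pose d k i := sqn (y k i 0).
pose L := diag_mx (\row_i (l i)%:C).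
have d0 k i : 0 <= d k i := sqn_ge0 _.
have dk k : \sum_i d k i <= 1.
  suff -> : \sum_i d k i = \sum_j sqn (w k j 0) by [].
  apply: (@complexI R); rewrite !sum_sqn /y trmx_mul map_mxM/=.
  by rewrite mulmxA -[_ *m _ *m P]mulmxA PP' mulmx1.
have Pk k : \sum_i sqn ((N *m w k) i 0) = \sum_i d k i * l i.
  apply: (@complexI R); rewrite sum_sqn trmx_mul map_mxM/=.
  rewrite mulmxA -[_ *m _ *m N]mulmxA NE.
  have -> : (w k)^t* *m (P^t* *m L *m P) *m w k = (y k)^t* *m (L *m y k).
    by rewrite /y trmx_mul map_mxM/= !mulmxA.
  rewrite /d; move: (y k) => yk; rewrite mxE rmorph_sum/=; apply: eq_bigr => i _.
  by rewrite rmorphM/= sqnE 2!mxE mul_diag_mx 2!mxE mulrCA mulrC [_^*%C * _]mulrC.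
(* By the frame identity, the overlaps with an eigenvector of nonzero eigenvalue sum to 1 over the
   outcomes; Jensen is then applied to each outcome. *)
have di i : l i * \sum_k d k i = l i.
  apply: (@complexI R).
  have -> : (l i)%:C = L i i by rewrite !mxE eqxx.
  have -> : L = \sum_k (L *m y k) *m (y k)^t*.
    have -> : L = P *m (N^t* *m N) *m P^t*.
      by rewrite NE !mulmxA PP mul1mx -mulmxA PP mulmx1.
    rewrite {2}frame mulmx_sumr mulmx_sumr mulmx_suml; apply: eq_bigr => k _.
    rewrite /y trmx_mul map_mxM/= !mulmxA; congr (_ *m _ *m _).
    by rewrite -[_ *m _ *m P]mulmxA PP' mulmx1.
  rewrite summxE rmorphM rmorph_sum/= mulr_sumr; apply: eq_bigr => k _.
  rewrite /d; move: (y k) => yk; rewrite !mxE big_ord1 mul_diag_mx !mxE.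
  by rewrite sqnE mulrA.
have step : \sum_i negxlog2x (l i) = \sum_k (\sum_i d k i * negxlnx (l i)) / ln 2.
  rewrite -mulr_suml exchange_big/= mulr_suml; apply: eq_bigr => i _.
  rewrite negxlog2xE -mulr_suml.
  have [li0|li0] := eqVneq (l i) 0; first by rewrite li0 negxlnx0 mulr0.
  by rewrite (mulfI li0 (etrans (di i) (esym (mulr1 _)))) mul1r.
rewrite step; apply: ler_sum => k _; rewrite negxlog2xE Pk.
rewrite ler_pM2r ?invr_gt0 ?ln2_gt0//.
exact: negxlnx_jensen.
Qed.
End Pinching.

(** * Gram-Schmidt for two possibly degenerate vectors *)

Section Frames.
Variable R : realType.
Local Notation C := R[i].

Lemma sum_unpair (V : nmodType) p q (F : 'I_p -> 'I_q -> V) :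
  \sum_(k < p * q) F (unpair k).1 (unpair k).2 = \sum_i \sum_j F i j.
Proof.
rewrite pair_big/= (reindex (fun ij : 'I_p * 'I_q => mxvec_index ij.1 ij.2))/=.
  apply: eq_bigr => -[i j] _ /=.
  by rewrite /unpair /mxvec_index cast_ordK enum_rankK.
exists (@unpair p q) => [[i j] _|k _].
  by rewrite /unpair /mxvec_index /= cast_ordK enum_rankK.
rewrite /mxvec_index -surjective_pairing /unpair enum_valK.
by apply: val_inj.
Qed.

Definition ip n (x y : 'I_n -> C) : C := \sum_r (x r)^*%C * y r.
Definition nrm2 n (x : 'I_n -> C) : R := \sum_r sqn (x r).

Lemma nrm2E n (x : 'I_n -> C) : (nrm2 x)%:C = ip x x.
Proof. by rewrite /nrm2 rmorph_sum/=; apply: eq_bigr => r _; rewrite sqnE mulrC. Qed.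

Lemma nrm2_ge0 n (x : 'I_n -> C) : 0 <= nrm2 x.
Proof. by apply: sumr_ge0 => r _; exact: sqn_ge0. Qed.

Lemma sqn_eq0 (z : C) : sqn z = 0 -> z = 0.
Proof.
case: z => a b; rewrite /sqn/= => /eqP; rewrite paddr_eq0 ?sqr_ge0//.
by rewrite !sqrf_eq0 => /andP[/eqP-> /eqP->].
Qed.

Lemma nrm2_eq0 n (x : 'I_n -> C) : nrm2 x = 0 -> forall r, x r = 0.
Proof.
move=> /eqP; rewrite psumr_eq0 => [/allP h r|r _]; last exact: sqn_ge0.
by apply: sqn_eq0; apply/eqP/h; rewrite mem_index_enum.
Qed.

Lemma ip_conj n (x y : 'I_n -> C) : ip y x = (ip x y)^*%C.
Proof.
rewrite /ip rmorph_sum/=; apply: eq_bigr => r _.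
by rewrite rmorphM/= conjcK mulrC.
Qed.

Lemma sqnM (z t : C) : sqn (z * t) = sqn z * sqn t.
Proof. by apply: (@complexI R); rewrite rmorphM/= !sqnE rmorphM/= mulrACA. Qed.

Lemma sqn_conj (z : C) : sqn z^*%C = sqn z.
Proof. by case: z => a b; rewrite /sqn/= sqrrN. Qed.

Lemma sqn_real (x : R) : sqn x%:C = x ^+ 2.
Proof. by rewrite /sqn/= expr0n/= addr0. Qed.

Lemma sqn0 : sqn (0 : C) = 0.
Proof. by rewrite -[0]/((0 : R)%:C) sqn_real expr0n. Qed.

(* The vector [x / |x|], which is [0] when [x = 0]. *)
Lemma normalize n (x : 'I_n -> C) : exists e : 'I_n -> C,
  [/\ nrm2 e <= 1, forall r, e r = ((Num.sqrt (nrm2 x))^-1)%:C * x r,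
      ip e x = (Num.sqrt (nrm2 x))%:C & forall r, x r = e r * ip e x].
Proof.
set a := Num.sqrt (nrm2 x); have a2 : a ^+ 2 = nrm2 x by rewrite sqr_sqrtr// nrm2_ge0.
exists (fun r => (a^-1)%:C * x r).
have [a0|a0] := eqVneq a 0.
  have x0 := nrm2_eq0 (etrans (esym a2) ltac:(by rewrite a0 expr0n)).
  split=> //.
  - by rewrite /nrm2 big1 ?ler01// => r _; rewrite x0 mulr0 sqn0.
  - by rewrite /ip a0 big1// => r _; rewrite x0 mulr0.
  - by move=> r; rewrite x0 mulr0 mul0r.
have ipE : ip (fun r => (a^-1)%:C * x r) x = a%:C.
  rewrite /ip; under eq_bigr do rewrite rmorphM/= oppr0 -mulrA.
  rewrite -mulr_sumr -/(ip x x) -nrm2E -a2 -[_ +i* 0]/((a^-1)%:C) -rmorphM/=.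
  by rewrite expr2 mulrA mulVf// mul1r.
split=> //.
- rewrite /nrm2; under eq_bigr do rewrite sqnM sqn_real.
  by rewrite -mulr_sumr -/(nrm2 x) -a2 -exprMn mulVf// expr1n.
- move=> r; rewrite ipE mulrAC -rmorphM/= mulVf//; exact: (esym (mul1r _)).
Qed.

Lemma ipB n (e x y : 'I_n -> C) c : ip e (fun r => y r - x r * c) = ip e y - ip e x * c.
Proof. by rewrite /ip mulr_suml -sumrB; apply: eq_bigr => r _; ring. Qed.

(** [e] carries [x], and [e'] what [y] has beyond [x]. The recorded numbers are those that enter
    outcome probabilities; for [x = 0] the quotients by [nrm2 x] are [0] by the convention on
    division by zero. *)
Definition adapted_frame n (x y e e' : 'I_n -> C) : Prop :=
  [/\ nrm2 e <= 1 /\ nrm2 e' <= 1,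
      forall r, x r = e r * ip e x /\ y r = e r * ip e y + e' r * ip e' y,
      ip e' x = 0,
      sqn (ip e x) = nrm2 x /\ (ip e x)^*%C * ip e y = ip x y &
      sqn (ip e y) = sqn (ip x y) / nrm2 x /\
      sqn (ip e' y) = nrm2 y - sqn (ip x y) / nrm2 x].

Lemma gram_schmidt n (x y : 'I_n -> C) : exists e e' : 'I_n -> C, adapted_frame x y e e'.
Proof.
have [e [e1 eE ex xE]] := normalize x.
set a := Num.sqrt _ in eE ex; have a2 : a ^+ 2 = nrm2 x by rewrite sqr_sqrtr// nrm2_ge0.
pose y' r := y r - e r * ip e y.
have [e' [e'1 e'E e'y' y'E]] := normalize y'.
have ey : ip e y = (a^-1)%:C * ip x y.
  rewrite /ip mulr_sumr; apply: eq_bigr => r _.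
  by rewrite eE rmorphM/= oppr0 mulrA.
(* [ip e e] is 1 unless [x = 0], and then [ip e y] vanishes. *)
have ee : ip e e * ip e y = ip e y.
  have [a0|a0] := eqVneq a 0.
    by rewrite ey a0 invr0 !(mul0r, mulr0).
  suff -> : ip e e = 1 by rewrite mul1r.
  rewrite /ip; under eq_bigr do rewrite [X in _ * X]eE mulrCA.
  rewrite -mulr_sumr -/(ip e x) ex -rmorphM/= mulVf//.
have ey' : ip e y' = 0 by rewrite ipB ee subrr.
have e'e : ip e' e = 0.
  rewrite ip_conj /ip; under eq_bigr do rewrite e'E mulrCA.
  by rewrite -mulr_sumr -/(ip e y') ey' mulr0; exact: conjc0.
have e'x : ip e' x = 0.
  rewrite /ip; under eq_bigr do rewrite xE mulrA.
  by rewrite -mulr_suml -/(ip e' e) e'e mul0r.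
have e'y : ip e' y = ip e' y' by rewrite /y' ipB e'e mul0r subr0.
have exy : (ip e x)^*%C * ip e y = ip x y.
  rewrite ex ey conjc_real mulrA -rmorphM/=.
  have [a0|a0] := eqVneq a 0; last by rewrite divff// mul1r.
  have x0 := nrm2_eq0 (etrans (esym a2) ltac:(by rewrite a0 expr0n)).
  by rewrite /ip big1 ?mulr0// => r _; rewrite x0 conjc0 mul0r.
have sey : sqn (ip e y) = sqn (ip x y) / nrm2 x.
  by rewrite ey sqnM sqn_real -a2 exprVn mulrC.
exists e, e'; split=> //.
- by move=> r; split=> //; rewrite e'y -y'E /y' addrCA subrr addr0.
- by split=> //; rewrite ex sqn_real.
- split=> //; rewrite e'y e'y' sqn_real sqr_sqrtr ?nrm2_ge0// -sey.
  apply: (@complexI R); rewrite rmorphB/= !nrm2E sqnE.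
  have -> : ip y' y' = ip y' y.
    by rewrite {2}/y' ipB (ip_conj e y') ey' conjc0 mul0r subr0.
  by rewrite (ip_conj y y') {1}/y' ipB rmorphB rmorphM/= -!ip_conj.
Qed.
End Frames.

(** * The gate in the eigenbasis of sigma_1 *)

Section XBasis.
Variable R : realType.
Local Notation C := R[i].

Definition isqrt2 : R := (Num.sqrt 2)^-1.

Lemma isqrt2_sq : isqrt2 ^+ 2 = 1 / 2.
Proof. by rewrite exprVn sqr_sqrtr// div1r. Qed.

(* [<a|+>] for [i = false] and [<a|->] for [i = true]. *)
Definition had (i : bool) (a : 'I_2) : R :=
  if i && (val a == 1%N) then - isqrt2 else isqrt2.

Definition xcomp m (phi : 'M[C]_(2, m)) (i : bool) (r : 'I_m) : C :=
  \sum_a (had i a)%:C * phi a r.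

(* Amplitude of the [sigma_1] eigenvectors [i], [j] in the output; the prefactor is the
   global phase [(1 + i) / sqrt 2]. *)
Definition xout (c S : R) m n (phi : bool -> 'I_m -> C) (psi : bool -> 'I_n -> C)
    (i j : bool) (ra : 'I_m) (rb : 'I_n) : C :=
  (isqrt2 +i* isqrt2) *
  (if i == j then phi i ra * psi j rb
   else (- 'i) * c%:C * phi i ra * psi j rb + S%:C * phi j ra * psi i rb).

Lemma sum2 (V : nmodType) (F : 'I_2 -> V) : \sum_a F a = F ord0 + F (lift ord0 ord0).
Proof. by rewrite !big_ord_recl big_ord0 addr0. Qed.

Lemma sum_bool (V : nmodType) (F : bool -> V) : \sum_i F i = F false + F true.
Proof. by rewrite big_bool addrC. Qed.

(** On equal signs [sigma_2 (x) sigma_2] and [sigma_3 (x) sigma_3] cancel; on opposite signs both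
    swap [+-] with [-+]. This leaves [c_0 + c_1] on equal signs, and [c_0 - c_1] plus [2 c_2] times
    the swap on opposite ones. The proof compares the four entries. *)
Lemma out_state_xout (y : R) m n (phi : 'M[C]_(2, m)) (psi : 'M[C]_(2, n)) a ra b rb :
  out_state (pauli_diag_gate (coefs y)) phi psi a ra b rb =
  \sum_(i : bool) \sum_(j : bool) (had i a)%:C * (had j b)%:C *
    xout (cos y ^+ 2 - sin y ^+ 2) (2 * sin y * cos y) (xcomp phi) (xcomp psi) i j ra rb.
Proof.
have cs : (cos y)%:C ^+ 2 = 1 - (sin y)%:C ^+ 2.
  by rewrite -[1]/((1 : R)%:C) -!rmorphXn -rmorphB/= -(cos2Dsin2 y) addrK.
have iE : Num.imaginary = (0 +i* 1)%C :> C by [].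
have i2 : 'i%C ^+ 2 = -1 :> C by rewrite sqr_i.
(* The two basis changes bring four factors [1 / sqrt 2] to the right side only; multiplying the
   left by this 1 balances them. *)
have h4 : 4 * isqrt2%:C ^+ 4 = 1 :> C.
  rewrite (_ : 4 = (4 : R)%:C); last by rewrite rmorph_nat.
  rewrite -rmorphXn -rmorphM/= (exprM _ 2 2) isqrt2_sq.
  by rewrite (_ : 4 * _ = 1)//; field.
have wE : isqrt2 +i* isqrt2 = isqrt2%:C * (1 + 'i) :> C.
  by rewrite -[1]/((1 : R)%:C); simpc.
rewrite /out_state /pauli_diag_gate /xout wE !sum2 !sum_bool /= /xcomp !sum2.
rewrite !big_ord_recl !big_ord0 /coefs /pauli /had /=.
case: a => -[|[|//]] ha; case: b => -[|[|//]] hb; rewrite !mxE/= ?eqE/=.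
all: rewrite -/isqrt2 !rmorphB ?rmorphN ?rmorphM/= ?rmorphXn/=.
all: rewrite (_ : (2 : R)%:C = 2) ?rmorph_nat//.
all: rewrite -[LHS]mul1r -{1}h4.
all: move: (phi ord0 ra) (phi (lift ord0 ord0) ra) => p0 p1.
all: move: (psi ord0 rb) (psi (lift ord0 ord0) rb) => q0 q1.
all: move: (isqrt2%:C) (cos y)%:C (sin y)%:C cs {wE h4} => h k l cs.
all: rewrite ?iE; ring: i2 cs.
Qed.
End XBasis.

Section Parseval.
Variable R : realType.
Local Notation C := R[i].

Lemma sqnD (z t : C) : sqn (z + t) = sqn z + sqn t + 2 * complex.Re (z^*%C * t).
Proof. by case: z => a b; case: t => c d; rewrite /sqn/=; ring. Qed.

Lemma had_parseval (z : bool -> C) :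
  \sum_a sqn (\sum_i (had R i a)%:C * z i) = \sum_i sqn (z i).
Proof.
rewrite sum2 !sum_bool /had/=.
have h2 := isqrt2_sq R; rewrite !sqnD !sqnM !sqn_real sqrrN h2.
case: (z false) => a b; case: (z true) => c d; rewrite /sqn/=; lra.
Qed.

Lemma had_parsevalV (z : 'I_2 -> C) :
  \sum_i sqn (\sum_a (had R i a)%:C * z a) = \sum_a sqn (z a).
Proof.
rewrite sum_bool !sum2 /had/=.
have h2 := isqrt2_sq R; rewrite !sqnD !sqnM !sqn_real sqrrN h2.
case: (z _) => a b; case: (z _) => c d; rewrite /sqn/=; lra.
Qed.

Lemma had_ortho (i j : bool) : \sum_a (had R i a) * (had R j a) = (i == j)%:R.
Proof.
have h2 := isqrt2_sq R; rewrite expr2 in h2.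
by rewrite sum2 /had; case: i j => -[]/=; rewrite ?mulrNN ?mulrN ?mulNr h2; lra.
Qed.

Lemma xcomp_norm m (phi : 'M[C]_(2, m)) : unit_state phi ->
  nrm2 (xcomp phi false) + nrm2 (xcomp phi true) = 1.
Proof.
move=> u; rewrite /nrm2 -(sum_bool (fun i => \sum_r sqn (xcomp phi i r))) exchange_big/=.
under eq_bigr do rewrite had_parsevalV; rewrite exchange_big/=.
apply: (@complexI R); rewrite -[RHS]u rmorph_sum/=; apply: eq_bigr => a _.
by rewrite rmorph_sum/=; apply: eq_bigr => r _; rewrite add_Re2_Im2.
Qed.

(** The squared norm of the Gram-Schmidt residual of [y] is nonnegative. *)
Lemma cauchy_schwarz n (x y : 'I_n -> C) : sqn (ip x y) <= nrm2 x * nrm2 y.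
Proof.
have [e [e' [_ _ _ _ [_ h]]]] := gram_schmidt x y.
have [x0|x0] := eqVneq (nrm2 x) 0.
  rewrite x0 mul0r /ip big1 ?sqn0// => r _; by rewrite (nrm2_eq0 x0) conjc0 mul0r.
have xp : 0 < nrm2 x by rewrite lt_neqAle eq_sym x0 nrm2_ge0.
by rewrite mulrC -ler_pdivrMr// -subr_ge0 -h sqn_ge0.
Qed.

Lemma sum_sqn_lin m (u v : C) (f g : 'I_m -> C) :
  \sum_r sqn (u * f r + v * g r) =
  sqn u * nrm2 f + sqn v * nrm2 g + 2 * complex.Re (u^*%C * v * ip f g).
Proof.
under eq_bigr do rewrite sqnD !sqnM.
rewrite !big_split/= -!mulr_sumr; congr (_ + 2 * _).
rewrite /ip mulr_sumr (raddf_sum (@complex.Re R : {additive Rcomplex R -> R})).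
by apply: eq_bigr => r _; congr complex.Re; rewrite rmorphM/=; ring.
Qed.
End Parseval.

(** * Measuring the output of Bob in the adapted frames *)

Section FrameMeasurement.
Variable R : realType.
Local Notation C := R[i].
Local Open Scope sesquilinear_scope.

Lemma conjcM (x y : C) : (x * y)^*%C = x^*%C * y^*%C. Proof. exact: rmorphM. Qed.

Section Frame.
Variables (c S : R) (m n : nat) (f : bool -> 'I_m -> C) (g : bool -> 'I_n -> C).
Variable (chi : 'I_2 -> 'I_m -> 'I_2 -> 'I_n -> C).
Hypothesis chiE : forall a ra b rb, chi a ra b rb =
  \sum_(i : bool) \sum_(j : bool) (had R i a)%:C * (had R j b)%:C * xout c S f g i j ra rb.

(** Rows belong to Alice and columns to Bob; the conjugate turns the reduced state into the Gram
    form that [pinching_bound] expects. *)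
Definition out_mx : 'M[C]_(2 * m, 2 * n) :=
  \matrix_(x, k) (chi (unpair x).1 (unpair x).2 (unpair k).1 (unpair k).2)^*%C.

Lemma reduced_BRBE : reduced_BRB chi = out_mx^t* *m out_mx.
Proof.
apply/matrixP => k l; rewrite !mxE.
pose F a ra := chi a ra (unpair k).1 (unpair k).2 * (chi a ra (unpair l).1 (unpair l).2)^*%C.
rewrite -[LHS]/(\sum_a \sum_ra F a ra) -(sum_unpair F); apply: eq_bigr => x _.
by rewrite !mxE conjC_conjc conjcK.
Qed.

Lemma xout_diag j ra rb : xout c S f g j j ra rb =
  (isqrt2 R +i* isqrt2 R) * f j ra * g j rb.
Proof. by rewrite /xout eqxx mulrA. Qed.

Lemma xout_offdiag j ra rb : xout c S f g (~~ j) j ra rb =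
  (isqrt2 R +i* isqrt2 R) *
  (- 'i%C * c%:C * f (~~ j) ra * g j rb + S%:C * f j ra * g (~~ j) rb).
Proof. by rewrite /xout; case: j. Qed.

Lemma sqn_phase : sqn (isqrt2 R +i* isqrt2 R) = 1.
Proof. by rewrite /sqn/= isqrt2_sq; lra. Qed.

(** For each sign [j] of Bob the frame starts from [g j]. The second outcome is orthogonal to [g j],
    so only the swap amplitude [S] reaches it; in the first, direct and swapped amplitudes
    interfere. *)
Lemma frame_bound s : vN_entropy (reduced_BRB chi) s ->
  s <= \sum_(j : bool)
    (negxlog2x (nrm2 (f j) * nrm2 (g j) + c ^+ 2 * nrm2 (f (~~ j)) * nrm2 (g j)
       + S ^+ 2 * nrm2 (f j) * (sqn (ip (g j) (g (~~ j))) / nrm2 (g j))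
       + 2 * c * S * complex.Re ('i%C * ip (g j) (g (~~ j)) * ip (f (~~ j)) (f j)))
    + negxlog2x (S ^+ 2 * nrm2 (f j) *
         (nrm2 (g (~~ j)) - sqn (ip (g j) (g (~~ j))) / nrm2 (g j)))).
Proof.
rewrite reduced_BRBE => hs.
have [e he] : exists e : bool -> bool -> 'I_n -> C,
    forall j, adapted_frame (g j) (g (~~ j)) (e j false) (e j true).
  have [u [u' hu]] := gram_schmidt (g false) (g true).
  have [v [v' hv]] := gram_schmidt (g true) (g false).
  by exists (fun j d => if j then (if d then v' else v) else (if d then u' else u)); case.
have e1 j d : nrm2 (e j d) <= 1 by case: (he j) => -[]; case: d.
have X0 j : ip (e j true) (g j) = 0 by case: (he j).
have eg j r : g j r = \sum_d e j d r * ip (e j d) (g j).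
  by rewrite sum_bool X0 mulr0 addr0; case: (he j) => _ /(_ r)[].
have egN j r : g (~~ j) r = \sum_d e j d r * ip (e j d) (g (~~ j)).
  by rewrite sum_bool; case: (he j) => _ /(_ r)[].
have XX j : sqn (ip (e j false) (g j)) = nrm2 (g j) by case: (he j) => _ _ _ [].
have XY j : (ip (e j false) (g j))^*%C * ip (e j false) (g (~~ j)) = ip (g j) (g (~~ j)).
  by case: (he j) => _ _ _ [].
have YY j : sqn (ip (e j false) (g (~~ j))) = sqn (ip (g j) (g (~~ j))) / nrm2 (g j).
  by case: (he j) => _ _ _ _ [].
have YY' j : sqn (ip (e j true) (g (~~ j))) =
    nrm2 (g (~~ j)) - sqn (ip (g j) (g (~~ j))) / nrm2 (g j).
  by case: (he j) => _ _ _ _ [].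
pose w (k : bool * bool) : 'cV[C]_(2 * n) :=
  \col_l ((had R k.1 (unpair l).1)%:C * e k.1 k.2 (unpair l).2).
pose q i j d ra := ip (e j d) (xout c S f g i j ra).
have ipl (h : 'I_n -> C) j ra : ip h (xout c S f g j j ra) =
    (isqrt2 R +i* isqrt2 R) * f j ra * ip h (g j).
  rewrite /ip mulr_sumr; apply: eq_bigr => r _; rewrite xout_diag; ring.
have ipl' (h : 'I_n -> C) j ra : ip h (xout c S f g (~~ j) j ra) =
    (isqrt2 R +i* isqrt2 R) * (- 'i%C * c%:C * f (~~ j) ra * ip h (g j)
       + S%:C * f j ra * ip h (g (~~ j))).
  rewrite /ip !mulr_sumr -big_split mulr_sumr/=; apply: eq_bigr => r _.
  rewrite xout_offdiag; ring.
have qE i j ra rb : xout c S f g i j ra rb = \sum_d e j d rb * q i j d ra.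
  have [->|/negPf ij] := eqVneq i j; last have -> : i = ~~ j by case: i j ij => -[].
    rewrite xout_diag eg mulr_sumr; apply: eq_bigr => d _; rewrite /q ipl; ring.
  rewrite xout_offdiag eg egN !mulr_sumr -big_split mulr_sumr/=.
  by apply: eq_bigr => d _; rewrite /q ipl'; ring.
have h2 : 2 * (isqrt2 R)%:C ^+ 2 = 1 :> C.
  rewrite -rmorphXn isqrt2_sq (_ : 2 = (2 : R)%:C); last by rewrite rmorph_nat.
  rewrite -rmorphM/= (_ : 2 * (1 / 2) = 1 :> R)//; lra.
have had_sum (X : bool -> C) j :
    \sum_b (\sum_i (had R i b)%:C * X i) * (had R j b)%:C = X j.
  rewrite sum2 !sum_bool /had -[RHS]mul1r -h2.
  by case: j => /=; rewrite ?rmorphN/=; ring.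
have Nw j d x : (out_mx *m w (j, d)) x 0 =
    \sum_i (had R i (unpair x).1)%:C * (q i j d (unpair x).2)^*%C.
  rewrite mxE; under eq_bigr do rewrite 2!mxE/=.
  set a := (unpair x).1; set ra := (unpair x).2.
  rewrite (sum_unpair (fun b rb => (chi a ra b rb)^*%C * ((had R j b)%:C * e j d rb))).
  rewrite exchange_big/= /q /ip.
  transitivity (\sum_rb (\sum_i (had R i a)%:C * (xout c S f g i j ra rb)^*%C) * e j d rb).
    apply: eq_bigr => rb _.
    rewrite -[in RHS](had_sum (fun j => \sum_i (had R i a)%:C * (xout c S f g i j ra rb)^*%C)).
    rewrite mulr_suml; apply: eq_bigr => b _; rewrite mulrA; congr (_ * _ * _).
    rewrite chiE exchange_big rmorph_sum/=; apply: eq_bigr => j' _.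
    rewrite rmorph_sum mulr_sumr/=; apply: eq_bigr => i _.
    by rewrite !conjcM !conjc_real; ring.
  rewrite (eq_bigr _ (fun rb _ => mulr_suml _ _ _ _)) exchange_big/=.
  apply: eq_bigr => i _.
  rewrite rmorph_sum mulr_sumr/=; apply: eq_bigr => rb _.
  by rewrite [((e j d rb)^*%C * _)^*%C]conjcM conjcK; ring.
have frame : out_mx = \sum_k (out_mx *m w k) *m (w k)^t*.
  apply/matrixP => x l; rewrite summxE.
  rewrite -(pair_bigA _ (fun j d => ((out_mx *m w (j, d)) *m (w (j, d))^t*) x l))/=.
  rewrite mxE chiE exchange_big rmorph_sum/=; apply: eq_bigr => j _.
  rewrite rmorph_sum/=.
  under eq_bigr do rewrite qE.
  transitivity (\sum_i \sum_d (had R i (unpair x).1)%:C * (had R j (unpair l).1)%:C *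
     ((e j d (unpair l).2)^*%C * (q i j d (unpair x).2)^*%C)).
    apply: eq_bigr => i _; rewrite !conjcM !conjc_real rmorph_sum mulr_sumr/=.
    by apply: eq_bigr => d _; rewrite conjcM.
  rewrite exchange_big/=; apply: eq_bigr => d _.
  rewrite mxE big_ord1 Nw !mxE/= mulr_suml; apply: eq_bigr => i _.
  by rewrite conjC_conjc conjcM conjc_real; ring.
have w1 k : \sum_l sqn (w k l 0) <= 1.
  case: k => j d; under eq_bigr do rewrite mxE sqnM/=.
  rewrite (sum_unpair (fun b rb => sqn (had R j b)%:C * sqn (e j d rb))).
  rewrite -big_distrlr/=.
  suff -> : \sum_i sqn (had R j i)%:C = 1 by rewrite mul1r; exact: e1.
  by under eq_bigr do rewrite sqn_real expr2; rewrite had_ortho eqxx.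
have Pk j d : \sum_x sqn ((out_mx *m w (j, d)) x 0) =
   sqn (ip (e j d) (g j)) * nrm2 (f j) +
   (c ^+ 2 * sqn (ip (e j d) (g j)) * nrm2 (f (~~ j)) +
    S ^+ 2 * sqn (ip (e j d) (g (~~ j))) * nrm2 (f j) +
    2 * c * S * complex.Re ('i%C * ((ip (e j d) (g j))^*%C * ip (e j d) (g (~~ j)))
      * ip (f (~~ j)) (f j))).
  under eq_bigr do rewrite Nw.
  rewrite (sum_unpair (fun a ra => sqn (\sum_i (had R i a)%:C * (q i j d ra)^*%C))).
  rewrite exchange_big/=; under eq_bigr do rewrite had_parseval.
  rewrite exchange_big/=.
  have -> (F : bool -> R) : \sum_i F i = F j + F (~~ j).
    by rewrite sum_bool; case: (j) => //; rewrite addrC.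
  congr (_ + _).
    under eq_bigr do rewrite sqn_conj /q ipl !sqnM sqn_phase mul1r mulrC.
    by rewrite -mulr_sumr.
  set X := ip _ (g j); set Y := ip _ (g (~~ j)).
  under eq_bigr do rewrite sqn_conj /q ipl' sqnM sqn_phase mul1r -/X -/Y.
  transitivity (\sum_ra sqn ((- 'i%C * c%:C * X) * f (~~ j) ra + (S%:C * Y) * f j ra)).
    by apply: eq_bigr => r _; congr sqn; ring.
  rewrite sum_sqn_lin !sqnM !sqn_real; congr (_ + _ + _).
    have -> : sqn (- 'i%C : C) = 1 by rewrite /sqn/= oppr0 expr0n sqrrN expr1n add0r.
    by rewrite mul1r.
  rewrite -!mulrA; congr (2 * _).
  case: X => x1 x2; case: Y => y1 y2; case: (ip _ _) => z1 z2.
  by rewrite /=; ring.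
apply: le_trans (pinching_bound w1 frame hs) _.
rewrite -(pair_bigA _ (fun j d => negxlog2x (\sum_i sqn ((out_mx *m w (j, d)) i 0))))/=.
rewrite le_eqVlt; apply/orP; left; apply/eqP.
apply: eq_bigr => j _; rewrite sum_bool !Pk XX XY YY YY' X0 sqn0.
congr (negxlog2x _ + negxlog2x _).
  by ring.
by rewrite conjc0 !(mul0r, mulr0) /=; ring.
Qed.
End Frame.
End FrameMeasurement.

(** * The upper bound *)

Section Exchange.
Variable R : realType.
Local Notation C := R[i].
Local Open Scope sesquilinear_scope.

Lemma vN_entropy_tr n (A : 'M[C]_n) s : vN_entropy A s -> vN_entropy A^T s.
Proof.
case=> rs [AE ->]; exists rs; split=> //; rewrite -AE /char_poly -[RHS]det_tr.
by congr (\det _); apply/matrixP => i j; rewrite !mxE eq_sym.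
Qed.

Lemma entanglement_swap (c : 'I_4 -> C) m n (phi : 'M[C]_(2, m)) (psi : 'M[C]_(2, n)) s :
  entanglement_of (pauli_diag_gate c) phi psi s ->
  entanglement_of (pauli_diag_gate c) psi phi s.
Proof.
rewrite /entanglement_of; set U := pauli_diag_gate c.
have chiE b rb a ra : out_state U psi phi b rb a ra = out_state U phi psi a ra b rb.
  rewrite /out_state exchange_big/=; apply: eq_bigr => a' _; apply: eq_bigr => b' _.
  rewrite mulrAC; congr (_ * _ * _); rewrite /U /pauli_diag_gate.
  by apply: eq_bigr => j _; rewrite mulrAC.
rewrite reduced_BRBE => /vN_entropy_mulC/vN_entropy_tr.
set M := (_ *m _)^T; suff -> : M = reduced_BRB (out_state U psi phi) by [].
apply/matrixP => x y; rewrite !mxE.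
under [RHS]eq_bigr do under eq_bigr do rewrite !chiE.
rewrite -(sum_unpair (fun b rb => out_state U phi psi (unpair x).1 (unpair x).2 b rb *
  (out_state U phi psi (unpair y).1 (unpair y).2 b rb)^*%C)).
by apply: eq_bigr => l _; rewrite !mxE conjC_conjc conjcK mulrC.
Qed.

Lemma addr_sqr_ge0 (x y K : R) : 0 <= x -> 0 <= y -> K ^+ 2 <= 4 * x * y -> 0 <= x + y + K.
Proof.
move=> x0 y0 hK; rewrite -[K]opprK subr_ge0 leNgt; apply/negP => h.
have : (x + y) ^+ 2 < (- K) ^+ 2 by rewrite ltr_pXn2r ?nnegrE ?addr_ge0//; lra.
have : 0 <= (x - y) ^+ 2 by rewrite sqr_ge0.
rewrite sqrrN; lra.
Qed.

Definition overlap n (g : bool -> 'I_n -> C) : R :=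
  sqn (ip (g false) (g true)) / (nrm2 (g false) * nrm2 (g true)).

Lemma overlapP n (g : bool -> 'I_n -> C) (F := overlap g) :
  [/\ 0 <= F <= 1, sqn (ip (g false) (g true)) = F * (nrm2 (g false) * nrm2 (g true)),
      sqn (ip (g false) (g true)) / nrm2 (g false) = F * nrm2 (g true) &
      sqn (ip (g false) (g true)) / nrm2 (g true) = F * nrm2 (g false)].
Proof.
have := cauchy_schwarz (g false) (g true).
have := sqn_ge0 (ip (g false) (g true)).
rewrite /F /overlap; set G := sqn _; set x := nrm2 _; set y := nrm2 _ => G0 Gxy.
have x0 : 0 <= x := nrm2_ge0 _; have y0 : 0 <= y := nrm2_ge0 _.
have [xy0|xy0] := eqVneq (x * y) 0.
  have -> : G = 0 by apply/eqP; rewrite eq_le G0 andbT -xy0.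
  by rewrite !mul0r lexx ler01.
have := xy0; rewrite mulf_eq0 negb_or => /andP[xn0 yn0].
split; last 1 first; try by field; rewrite xn0 yn0.
  by rewrite divr_ge0 ?mulr_ge0//= ler_pdivrMr ?mul1r// lt_neqAle eq_sym xy0 mulr_ge0.
Qed.
End Exchange.

Section EntropyBounds.
Variable R : realType.
Local Notation C := R[i].

Lemma Re_sqr_le_sqn (z : C) : complex.Re z ^+ 2 <= sqn z.
Proof. by rewrite /sqn lerDl sqr_ge0. Qed.

Section UpperBound.
Variables (c S sg : R).
Hypotheses (S2 : S ^+ 2 = sg) (cS : c ^+ 2 = 1 - sg) (sg01 : 0 < sg < 1).

Lemma one_side_bound m n (f : bool -> 'I_m -> C) (g : bool -> 'I_n -> C)
    (a := nrm2 (f false)) (b := nrm2 (g false))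
    (w := a * (1 - b) + (1 - a) * b) chi s :
  (forall a ra b rb, chi a ra b rb =
    \sum_(i : bool) \sum_(j : bool) (had R i a)%:C * (had R j b)%:C *
      xout c S f g i j ra rb) ->
  nrm2 (f false) + nrm2 (f true) = 1 -> nrm2 (g false) + nrm2 (g true) = 1 ->
  vN_entropy (reduced_BRB chi) s ->
  sg * w * (1 - overlap g) <= sg / 2 \/
    sg / 2 < sg * w * (1 - overlap f) /\ 0 <= (1 - a - b) * (a - b) ->
  s <= (ln 2 + negxlnx (sg / 2) + negxlnx (1 - sg / 2)) / ln 2.
Proof.
move=> chiE f1 g1 hs hc.
have f1' : nrm2 (f true) = 1 - a by rewrite -f1 /a addrC addKr.
have g1' : nrm2 (g true) = 1 - b by rewrite -g1 /b addrC addKr.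
have a0 : 0 <= a := nrm2_ge0 _; have b0 : 0 <= b := nrm2_ge0 _.
have a1 : 0 <= 1 - a by rewrite -f1' nrm2_ge0.
have b1 : 0 <= 1 - b by rewrite -g1' nrm2_ge0.
have := overlapP f; have := overlapP g; rewrite f1' g1' -/a -/b.
move: (overlap f) (overlap g) hc => FA F hc [F01 GE Gb Gb1] [FA01 HE _ _].
apply: le_trans (frame_bound chiE hs) _.
rewrite sum_bool/= !negxlog2xE -!mulrDl ler_pM2r ?invr_gt0 ?ln2_gt0//.
set z := 'i%C * ip (g false) (g true) * ip (f true) (f false).
have -> : complex.Re ('i%C * ip (g true) (g false) * ip (f false) (f true)) = - complex.Re z.
  rewrite /z (ip_conj (g false)) (ip_conj (f true)).
  by case: (ip (g _) _) => x1 x2; case: (ip (f _) _) => y1 y2; rewrite /=; ring.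
rewrite (ip_conj (g false) (g true)) sqn_conj f1' g1' -/a -/b Gb Gb1 cS S2.
rewrite mulrN.
set K := 2 * c * S * complex.Re z.
case/andP: (sg01) => s0 s1; case/andP: (F01) => F0 F1; case/andP: (FA01) => FA0 FA1.
have s1' : 0 <= 1 - sg by lra.
have s4 : 0 <= 4 * sg * (1 - sg) by rewrite !mulr_ge0// ltW.
have hKE : 4 * sg * (1 - sg) * (F * FA * (a * (1 - a) * b * (1 - b))) =
    4 * sg * (1 - sg) * F * FA * (a * (1 - a) * b * (1 - b)) by ring.
have hK : K ^+ 2 <= 4 * sg * (1 - sg) * F * FA * (a * (1 - a) * b * (1 - b)).
  have -> : K ^+ 2 = 4 * sg * (1 - sg) * complex.Re z ^+ 2 by rewrite -cS -S2 /K; ring.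
  rewrite -hKE ler_wpM2l//.
  apply: le_trans (Re_sqr_le_sqn z) _.
  rewrite /z !sqnM (ip_conj (f false) (f true)) sqn_conj GE HE.
  rewrite (_ : sqn 'i%C = 1 :> R); last by rewrite /sqn/= expr0n expr1n add0r.
  lra.
have Fab : F * FA * (a * (1 - a) * b * (1 - b)) <= F * (a * (1 - a) * b * (1 - b)).
  rewrite ler_wpM2r ?mulr_ge0//; exact: ler_piMr.
have hK' : K ^+ 2 <= 4 * sg * (1 - sg) * (F * (a * (1 - a) * b * (1 - b))).
  by apply: le_trans hK _; rewrite -hKE ler_wpM2l.
have := @four_outcome_entropy _ sg a b F FA K _ _ _ _ sg01 ltac:(lra) ltac:(lra) F01 FA01 hK
  erefl erefl erefl erefl _ _ hc.
set P1 := (X in 0 <= X); set P3 := (X in _ -> 0 <= X -> _) => H.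
have P10 : 0 <= P1.
  have := @addr_sqr_ge0 _ ((1 - sg) * (1 - a) * b) (sg * a * (1 - b) * F) K.
  have : 0 <= a * b by rewrite mulr_ge0.
  rewrite /P1 => ab h.
  suff : 0 <= (1 - sg) * (1 - a) * b + sg * a * (1 - b) * F + K by lra.
  apply: h; rewrite ?mulr_ge0 ?(ltW s0)//; lra.
have P30 : 0 <= P3.
  have := @addr_sqr_ge0 _ ((1 - sg) * a * (1 - b)) (sg * (1 - a) * b * F) (- K).
  have : 0 <= (1 - a) * (1 - b) by rewrite mulr_ge0.
  rewrite /P3 => ab h.
  suff : 0 <= (1 - sg) * a * (1 - b) + sg * (1 - a) * b * F - K by lra.
  apply: h; rewrite ?mulr_ge0 ?(ltW s0)// sqrrN; lra.
apply: le_trans (H P10 P30); rewrite le_eqVlt; apply/orP; left; apply/eqP.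
rewrite /P1 /P3 !addrA; congr (negxlnx _ + negxlnx _ + negxlnx _ + negxlnx _); ring.
Qed.

Lemma two_sided_bound (cf : 'I_4 -> C) m n (phi : 'M[C]_(2, m)) (psi : 'M[C]_(2, n)) s :
  (forall m n (phi : 'M[C]_(2, m)) (psi : 'M[C]_(2, n)) a ra b rb,
    out_state (pauli_diag_gate cf) phi psi a ra b rb =
    \sum_(i : bool) \sum_(j : bool) (had R i a)%:C * (had R j b)%:C *
      xout c S (xcomp phi) (xcomp psi) i j ra rb) ->
  unit_state phi -> unit_state psi ->
  entanglement_of (pauli_diag_gate cf) phi psi s ->
  s <= (ln 2 + negxlnx (sg / 2) + negxlnx (1 - sg / 2)) / ln 2.
Proof.
move=> outE /xcomp_norm f1 /xcomp_norm g1 hs.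
have bnd := one_side_bound (outE _ _ phi psi) f1 g1 hs.
have bnd' := one_side_bound (outE _ _ psi phi) g1 f1 (entanglement_swap hs).
move: bnd bnd'; set a := nrm2 (xcomp phi false); set b := nrm2 (xcomp psi false).
rewrite /= (_ : b * (1 - a) + (1 - b) * a = a * (1 - b) + (1 - a) * b); last by ring.
set w := _ + _; move=> bnd bnd'.
have [h|h] := leP (sg * w * (1 - overlap (xcomp psi))) (sg / 2); first by apply: bnd; left.
have [h'|h'] := leP (sg * w * (1 - overlap (xcomp phi))) (sg / 2); first by apply: bnd'; left.
have [e|e] := leP 0 ((1 - a - b) * (a - b)); first by apply: bnd; right.
apply: bnd'; right; split=> //.
by rewrite (_ : _ * _ = - ((1 - a - b) * (a - b))) ?oppr_ge0 ?ltW//; ring.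
Qed.
End UpperBound.

Lemma negxlnx_half (x : R) : 0 <= x -> 2 * negxlnx (x / 2) = negxlnx x + x * ln 2.
Proof.
rewrite le_eqVlt => /predU1P[<-|x0]; first by rewrite !mul0r negxlnx0 mulr0 addr0.
by rewrite /negxlnx ln_div ?posrE//; lra.
Qed.

Lemma shannon_value (q : R) : 0 <= q <= 1 ->
  shannon [:: (1 - q) / 2; (1 - q) / 2; q / 2; q / 2] =
  (ln 2 + negxlnx q + negxlnx (1 - q)) / ln 2.
Proof.
move=> /andP[q0 q1]; rewrite /shannon !big_cons big_nil !negxlog2xE addr0 -!mulrDl.
congr (_ / _); have := negxlnx_half q0.
have := @negxlnx_half (1 - q) ltac:(lra); lra.
Qed.

Lemma coefs_sqn (y : R) (j : 'I_4) : sqn (coefs y j) =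
  if (val j < 2)%N then (cos y ^+ 4 + sin y ^+ 4) / 2 else sin y ^+ 2 * cos y ^+ 2.
Proof.
have h2 := isqrt2_sq R.
by case: j => -[|[|[|[|//]]]] hj; rewrite /coefs/= !sqnM ?sqn_real -/(isqrt2 R) h2
  /sqn/=; field.
Qed.
End EntropyBounds.

(** * Bell inputs *)

Section Bell.
Variable R : realType.
Local Notation C := R[i].
Local Open Scope sesquilinear_scope.

Lemma vN_entropy_diag n (l : 'I_n -> R) :
  vN_entropy (diag_mx (\row_i (l i)%:C)) (\sum_i negxlog2x (l i)).
Proof.
exists [seq (l i)%:C | i <- enum 'I_n]; split; last by rewrite big_map big_enum.
rewrite big_map big_enum char_poly_trig ?diag_mx_is_trig//.
by apply: eq_bigr => i _; rewrite !mxE eqxx mulr1n.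
Qed.

Definition pauli_basis : 'M[C]_(2 * 2, 4) :=
  \matrix_(k, j) ((isqrt2 R)%:C * pauli R j (unpair k).1 (unpair k).2).

Lemma pauli_basis_ortho : pauli_basis^t* *m pauli_basis = 1%:M.
Proof.
have iE : Num.imaginary = (0 +i* 1)%C :> C by [].
have h2 := isqrt2_sq R.
apply/matrixP => j l; rewrite !mxE; under eq_bigr do rewrite !mxE.
rewrite (sum_unpair (fun a b => ((isqrt2 R)%:C * pauli R j a b)^*%R *
  ((isqrt2 R)%:C * pauli R l a b))) !sum2 !conjC_conjc.
case: j => -[|[|[|[|//]]]] hj; case: l => -[|[|[|[|//]]]] hl; rewrite /pauli/= !mxE/=.
all: rewrite ?iE; apply/eqP; rewrite eq_complex/=; apply/andP; split; apply/eqP.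
all: rewrite ?mulr1n ?mulr0n /=; lra.
Qed.

Lemma bell_unit : unit_state (bell R).
Proof.
rewrite /unit_state !sum2 !mxE/= normr0 expr0n/= addr0 add0r.
rewrite -add_Re2_Im2/= expr0n/= addr0 -/(isqrt2 R) isqrt2_sq.
by rewrite -rmorphD/= (_ : 1 / 2 + 1 / 2 = 1 :> R)//; lra.
Qed.

Lemma bell_sum (F : 'I_2 -> C) (r : 'I_2) : \sum_a F a * bell R a r = F r * (isqrt2 R)%:C.
Proof.
rewrite (bigD1 r)//= mxE eqxx big1 ?addr0// => a /negPf ar.
by rewrite mxE ar mulr0.
Qed.

Lemma bell_entanglement (cf : 'I_4 -> C) :
  entanglement_of (pauli_diag_gate cf) (bell R) (bell R) (\sum_j negxlog2x (sqn (cf j))).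
Proof.
rewrite /entanglement_of reduced_BRBE.
pose V := pauli_basis; pose D := diag_mx (\row_j cf j).
pose E := diag_mx (\row_j (sqn (cf j))%:C).
pose X := V *m D *m V^T.
have VV : V^T *m map_mx Num.conj V = 1%:M.
  have := congr1 (fun A => map_mx Num.conj A) pauli_basis_ortho.
  by rewrite map_mxM map_mx1 -map_mx_comp (map_mx_id (@conjCK _)).
have XE : out_mx (out_state (pauli_diag_gate cf) (bell R) (bell R)) = map_mx Num.conj X.
  apply/matrixP => x k; rewrite mxE [RHS]mxE conjC_conjc; congr conjc.
  rewrite /out_state (eq_bigr _ (fun a' _ => bell_sum _ _)) -mulr_suml bell_sum.
  rewrite /pauli_diag_gate !mulr_suml mxE; apply: eq_bigr => j _.
  by rewrite mul_mx_diag !mxE; ring.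
have -> : (out_mx (out_state (pauli_diag_gate cf) (bell R) (bell R)))^t* *m
    out_mx (out_state (pauli_diag_gate cf) (bell R) (bell R)) = V *m (E *m V^t*).
  rewrite XE.
  have -> : (map_mx Num.conj X)^t* = X.
    rewrite map_trmx -map_mx_comp (map_mx_id (@conjCK _)).
    by rewrite /X !trmx_mul trmxK tr_diag_mx mulmxA.
  rewrite /X !map_mxM/= -!mulmxA [V^T *m _]mulmxA VV mul1mx.
  rewrite [D *m _]mulmxA; congr (_ *m (_ *m _)).
  rewrite /D map_diag_mx mulmx_diag; congr diag_mx.
  by apply/rowP => j; rewrite !mxE sqnE.
apply: vN_entropy_mulC; rewrite -mulmxA pauli_basis_ortho mulmx1.
exact: vN_entropy_diag.
Qed.
End Bell.

Unset Implicit Arguments. Set Strict Implicit. Set Printing Implicit Defensive.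

Theorem theorem3 (R : realType) (y : R) (hy0 : 0 < y) (hy1 : y < pi / 4) :
  let c := coefs y in
  let U := pauli_diag_gate c in
  let HK := shannon [:: Normc.normc (c 0) ^+ 2; Normc.normc (c 0) ^+ 2;
                        Normc.normc (c 2) ^+ 2; Normc.normc (c 2) ^+ 2] in
  [/\ entangling_power_is U HK,
      HK = shannon [:: (cos y ^+ 4 + sin y ^+ 4) / 2; (cos y ^+ 4 + sin y ^+ 4) / 2;
                       sin y ^+ 2 * cos y ^+ 2; sin y ^+ 2 * cos y ^+ 2]
    & entanglement_of U (bell R) (bell R) HK].
Proof.
move=> c U HK.
have cs := cos2Dsin2 y.
have normE (z : R[i]) : Normc.normc z ^+ 2 = sqn z.
  by case: z => a b; rewrite /Normc.normc sqr_sqrtr// addr_ge0// sqr_ge0.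
have HKE : HK = shannon [:: (cos y ^+ 4 + sin y ^+ 4) / 2; (cos y ^+ 4 + sin y ^+ 4) / 2;
                       sin y ^+ 2 * cos y ^+ 2; sin y ^+ 2 * cos y ^+ 2].
  by rewrite /HK !normE !coefs_sqn.
have bellE : entanglement_of U (bell R) (bell R) HK.
  have := bell_entanglement c; rewrite HKE /shannon !big_cons big_nil.
  by rewrite !big_ord_recl big_ord0 !coefs_sqn.
split=> //; split; last first.
  by exists 2%N, 2%N, (bell R), (bell R); split; [|split] => //; exact: bell_unit.
move=> m n phi psi s u1 u2 hs.
pose sg := (2 * sin y * cos y) ^+ 2.
have s4 : (cos y ^+ 4 + sin y ^+ 4) / 2 = (1 - sg / 2) / 2.
  have -> : cos y ^+ 4 + sin y ^+ 4 = (cos y ^+ 2 + sin y ^+ 2) ^+ 2 - sg / 2.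
    by rewrite /sg; field.
  by rewrite cs expr1n.
have s2 : sin y ^+ 2 * cos y ^+ 2 = sg / 2 / 2 by rewrite /sg; field.
have sp : 0 < sin y by apply: sin_gt0_pi; have := pi_gt0 R; lra.
have cp : 0 < cos y by apply: cos_gt0_pihalf; have := pi_gt0 R; lra.
have cl : (cos y ^+ 2 - sin y ^+ 2) ^+ 2 = 1 - sg.
  have -> : (cos y ^+ 2 - sin y ^+ 2) ^+ 2 = (cos y ^+ 2 + sin y ^+ 2) ^+ 2 - sg.
    by rewrite /sg; ring.
  by rewrite cs expr1n.
have cp2 : 0 < cos y ^+ 2 - sin y ^+ 2.
  have := @cos_gt0_pihalf R (y + y) ltac:(have := pi_gt0 R; lra).
  by rewrite cosD -!expr2.
have sg01 : 0 < sg < 1.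
  by rewrite /sg exprn_gt0 ?mulr_gt0//= -subr_gt0 -/sg -cl exprn_gt0.
rewrite HKE s4 s2 shannon_value; last lra.
apply: (two_sided_bound (erefl _) cl sg01 _ u1 u2 hs) => *.
exact: out_state_xout.
Qed.
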